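(* With $U$, $a_\pm$ and $c(x)=\frac12x^2$ (so $c'(x)=x$) as in the context: (i) The maps $y\mapsto a_\pm(y)$ are non-increasing. Moreover, $a_-$ is right-continuous and $a_+$ is left-continuous. (ii) For any $y\in\mathbb{R}$, $a_+(y)\le(c')^{-1}(-K_+\delta)<(c')^{-1}(K_-\delta)\le a_-(y)$. (iii) For any $y\in\mathbb{R}$, $a_+(y)>-\infty$ and $a_-(y)<+\infty$. (iv) $a_+$ and $a_-$ are Lipschitz continuous on $\mathbb{R}$.
   Context: Let $m\in\mathbb{R}$, $b,\delta,\sigma_1,\sigma_2,K_+,K_->0$ with $b>\delta$, and let $W^1,W^2$ be Brownian motions on a complete filtered probability space with correlation $\rho$, $|\rho|<1$. For $(x,y)\in\mathbb{R}^2$, $(X^{x,y},Y^y)$ solves $$dX_t=(Y_t-\delta X_t)dt+\sigma_1dW^1_t,\ X_0=x;\qquad dY_t=(m-bY_t)dt+\sigma_2dW^2_t,\ Y_0=y.$$ Define $$U(x,y)=\inf_\tau\sup_\theta\mathbb{E}\Big[\int_0^{\tau\wedge\theta}e^{-\delta t}c'(X^{x,y}_t)dt+K_-e^{-\delta\tau}\mathbf{1}_{\tau<\theta}-K_+e^{-\delta\theta}\mathbf{1}_{\theta<\tau}\Big],$$ with $\tau,\theta$ stopping times of the filtration generated by the Brownian motions, and $$a_-(y)=\inf\{x\in\mathbb{R}:U(x,y)\ge K_-\},\qquad a_+(y)=\sup\{x\in\mathbb{R}:U(x,y)\le-K_+\},$$ with the conventions $\sup\emptyset=-\infty$, $\inf\emptyset=+\infty$.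 *)

(* Defs.v *)
From HB Require Import structures.
From mathcomp Require Import all_boot all_order all_algebra.
From mathcomp Require Import all_classical all_reals all_analysis.

Set Implicit Arguments.
Unset Strict Implicit.
Unset Printing Implicit Defensive.

Import Order.TTheory GRing.Theory Num.Theory.
Import numFieldNormedType.Exports.

Local Open Scope classical_set_scope.
Local Open Scope ring_scope.

(* Processes are indexed by all of R; only times 0 <= t matter. *)

(* A complete filtration: it is increasing and each F t contains the P-null
   sets.  Since F t consists of events, P itself is then complete. *)
Definition complete_filtration (R : realType) (d : measure_display)
    (Omega : measurableType d) (P : probability Omega R)
    (F : R -> set (set Omega)) : Prop :=
  [/\ forall t, 0 <= t -> sigma_algebra setT (F t),
      forall t, 0 <= t -> F t `<=` measurable,
      forall s t, 0 <= s -> s <= t -> F s `<=` F t &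
      forall t, 0 <= t -> P.-negligible `<=` F t].

Definition adapted (R : realType) (d : measure_display)
    (Omega : measurableType d) (F : R -> set (set Omega))
    (Z : R -> Omega -> R) : Prop :=
  forall t, 0 <= t -> forall B : set R, measurable B -> F t (Z t @^-1` B).

Definition continuous_path (R : realType) (Omega : Type)
    (Z : R -> Omega -> R) (w : Omega) : Prop :=
  {within `[0, +oo[, continuous (fun t => Z t w)}.

(* Two Brownian motions with respect to F with d<W1, W2>_t = rho dt: for s < t,
   the pair of increments over [s, t] is independent of F s and centred
   Gaussian with covariance matrix (t - s) * [1, rho; rho, 1], the law being
   given through its one-dimensional projections.  The second argument of
   [normal_prob] is the standard deviation, required to be nonzero here. *)
Definition correlated_brownian_motions (R : realType) (d : measure_display)
    (Omega : measurableType d) (P : probability Omega R)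
    (F : R -> set (set Omega)) (rho : R) (W1 W2 : R -> Omega -> R) : Prop :=
  [/\ adapted F W1 /\ adapted F W2,
      {ae P, forall w, W1 0 w = 0 /\ W2 0 w = 0},
      {ae P, forall w, continuous_path W1 w /\ continuous_path W2 w},
      forall s t, 0 <= s -> s < t ->
        forall (A : set Omega) (C : set (R * R)), F s A -> measurable C ->
        let D := [set w | C (W1 t w - W1 s w, W2 t w - W2 s w)] in
        P (A `&` D) = (P A * P D)%E &
      forall s t, 0 <= s -> s < t ->
        forall u v : R, (u, v) != (0, 0) ->
        forall B : set R, measurable B ->
        P [set w | B (u * (W1 t w - W1 s w) + v * (W2 t w - W2 s w))] =
        normal_prob 0
          (Num.sqrt ((t - s) * (u ^+ 2 + 2 * rho * u * v + v ^+ 2))) B].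

(* The P-augmentation of the filtration generated by (W1, W2). *)
Definition brownian_filtration (R : realType) (d : measure_display)
    (Omega : measurableType d) (P : probability Omega R)
    (W1 W2 : R -> Omega -> R) (t : R) : set (set Omega) :=
  <<s [set A | exists s : R, 0 <= s <= t /\
         exists B : set R, measurable B /\
           (A = W1 s @^-1` B \/ A = W2 s @^-1` B)]
      `|` P.-negligible >>.

Definition stopping_time (R : realType) (d : measure_display)
    (Omega : measurableType d) (G : R -> set (set Omega))
    (tau : Omega -> \bar R) : Prop :=
  (forall w, (0 <= tau w)%E) /\
  (forall t, 0 <= t -> G t [set w | (tau w <= t%:E)%E]).

(* The noise is additive with constant coefficients, so the stochastic
   integral of sigma_i against W^i over [0, t] is sigma_i * W^i_t. *)
Definition solves_sde (R : realType) (d : measure_display)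
    (Omega : measurableType d) (P : probability Omega R)
    (F : R -> set (set Omega)) (W1 W2 : R -> Omega -> R)
    (m b delta sigma1 sigma2 x y : R) (X Y : R -> Omega -> R) : Prop :=
  [/\ adapted F X /\ adapted F Y,
      {ae P, forall w, continuous_path X w /\ continuous_path Y w},
      {ae P, forall w, forall t : R, 0 <= t ->
        X t w = x + \int[lebesgue_measure]_(s in `[0, t]) (Y s w - delta * X s w)
                  + sigma1 * W1 t w} &
      {ae P, forall w, forall t : R, 0 <= t ->
        Y t w = y + \int[lebesgue_measure]_(s in `[0, t]) (m - b * Y s w)
                  + sigma2 * W2 t w}].

Definition cost (R : realType) (x : R) : R := x ^+ 2 / 2.

Definition dcost (R : realType) : R -> R := derive1 (@cost R : R -> R).

Definition dcost_inv (R : realType) : R -> R :=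
  'pinv_(fun=> 0) [set: R] (@dcost R).

(* Stopping times may be infinite; when tau < theta (resp. theta < tau), tau
   (resp. theta) is finite, so that [fine] is harmless. *)
Definition game_payoff (R : realType) (Omega : Type) (delta Kp Km : R)
    (X : R -> Omega -> R) (tau theta : Omega -> \bar R) (w : Omega) : R :=
  \int[lebesgue_measure]_(t in
     [set t : R | 0 <= t /\ (t%:E <= Order.min (tau w) (theta w))%E])
     (expR (- delta * t) * dcost (X t w))
  + Km * expR (- delta * fine (tau w)) * (tau w < theta w)%E%:R
  - Kp * expR (- delta * fine (theta w)) * (theta w < tau w)%E%:R.

(* X x y is the first component of the solution started from (x, y). *)
Definition game_value (R : realType) (d : measure_display)
    (Omega : measurableType d) (P : probability Omega R)
    (G : R -> set (set Omega)) (delta Kp Km : R)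
    (X : R -> R -> R -> Omega -> R) (x y : R) : \bar R :=
  ereal_inf [set ereal_sup
      [set 'E_P[game_payoff delta Kp Km (X x y) tau theta]%E
         | theta in stopping_time G]
    | tau in stopping_time G].

Definition a_minus (R : realType) (U : R -> R -> \bar R) (Km : R) (y : R) :
    \bar R :=
  ereal_inf [set x%:E | x in [set x : R | (Km%:E <= U x y)%E]].

Definition a_plus (R : realType) (U : R -> R -> \bar R) (Kp : R) (y : R) :
    \bar R :=
  ereal_sup [set x%:E | x in [set x : R | (U x y <= (- Kp)%:E)%E]].

(* Main.v *)
Require Import Defs.
From HB Require Import structures.
From mathcomp Require Import all_boot all_order all_algebra.
From mathcomp Require Import all_classical all_reals all_analysis.
From mathcomp Require Import ring lra measurable_realfun.

(** Everything follows from three facts about the value U of the game.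

    Comparison.  Two solutions driven by the same noise differ by a
    deterministic function: with L = 1 / (b - delta),
      X' - X = (x' - x + (y' - y) L) exp (- delta t) - (y' - y) L exp (- b t)
    ([sde_path_difference]).  Since exp (- b t) <= exp (- delta t), this is
    nonnegative as soon as x <= x' and x' - x + (y' - y) L >= 0, and then
    U x y <= U x' y' ([game_value_mono]).  So U is nondecreasing in both
    variables, and U x (y + h) <= U (x + L h) y for h >= 0.  The first property
    makes the boundaries nonincreasing, the second one says that they cannot
    decrease faster than with slope L; hence they are Lipschitz, and their
    one-sided continuity comes for free.

    Position of the boundaries.  If x < Km delta, the minimiser does better than
    Km by stopping at a small deterministic time t0: compared with paying Km at
    once, the interest saved exceeds the running cost by an amount of order t0,
    whereas the fluctuations of X up to t0 cost only O (t0 ^ (3/2)), whatever the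
    opponent does ([game_value_lt_Km]).

    Finiteness.  For large x, the maximiser answers every tau by never
    stopping.  The payoff is then
      Km + int_0^tau exp (- delta t) (X_t - delta Km) dt,
    and X_t is x exp (- delta t) plus a fluctuation.  The term in x contributes
    at least x / 2 times the discounted duration D = int_0^tau exp (- delta t) dt,
    so it suffices that the discounted fluctuation be at most a constant times
    E D, uniformly in tau ([game_value_ge_Km]).  The statements about a_+ are
    obtained by exchanging the players and changing the sign of X.

    Both quantitative points rest on one estimate, valid for every stopping time:
      E int_0^tau exp (- lam t) W_t ^ 2 dt <= (6 / lam) E int_0^tau exp (- lam t) dt
    ([discounted_second_moment]).  It needs no stochastic calculus: the function
    f t = E [W_t ^ 2; t <= tau] satisfies f t <= f s + 6 (t - s) P (s <= tau) for
    s < t, because increments are symmetric and independent of the past; hence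
    f t <= 6 int_0^t P (s <= tau) ds, and Fubini concludes.  The passage from W to
    X is pathwise: variation of constants bounds X by W and by running integrals
    of W, and under an integral discounted at rate lam a running integral
    costs only a factor 1 / lam ([discounted_running]). *)

Set Implicit Arguments.
Unset Strict Implicit.
Unset Printing Implicit Defensive.

Import Order.TTheory GRing.Theory Num.Theory.
Import numFieldNormedType.Exports.

Local Open Scope classical_set_scope.
Local Open Scope ring_scope.

(** * Variation of constants for a linear equation *)

Lemma continuous_expRM (R : realType) (a : R) : continuous (fun t : R => expR (a * t)).
Proof.
move=> z; apply: continuous_comp; last exact: continuous_expR.
by apply: (@continuousM R R (fun=> a) id); [exact: cst_continuous|exact: cvg_id].
Qed.

Lemma measurable_expRM (R : realType) (a : R) (D : set R) :
  measurable_fun D (fun t : R => expR (a * t)).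
Proof.
apply: measurable_funTS; apply: continuous_measurable_fun.
exact: continuous_expRM.
Qed.

(** Freezing a path at its value at time 0 makes it continuous on the whole
    line, so that no continuity relative to a half-line appears afterwards. *)
Lemma continuous_halfline_ext (R : realType) (f : R -> R) :
  {within `[0, +oo[, continuous f} -> continuous (fun t : R => f (Num.max t 0)).
Proof.
move=> /(@subspace_continuousP R (`[0, +oo[ : set R) R f) cf t.
have m0 (u : R) : (`[0, +oo[%classic : set R) (Num.max u 0).
  by rewrite /= in_itv/= andbT le_max lexx orbT.
apply: (cvg_trans _ (cf (Num.max t 0) (m0 t))) => /=.
move=> S; rewrite /= !nbhs_simpl/= => wS.
have cm : continuous (fun u : R => Num.max u 0).
  have -> : (fun u : R => Num.max u 0) = (fun u => (u + `|u|) / 2).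
    by apply/funext => v; rewrite maxr_absE subr0 addr0.
  move=> u; apply: (@continuousM R R (fun u => u + `|u|) (fun=> 2^-1)).
    by apply: (@continuousD R R R id); [exact: cvg_id|exact: norm_continuous].
  exact: cst_continuous.
have := cm t _ wS; rewrite nbhs_simpl/=; apply: (@filterS _ (nbhs t)) => u; apply; exact: m0.
Qed.

Lemma continuous_integrable_itv (R : realType) (f : R -> R) (a b : R) :
  continuous f -> lebesgue_measure.-integrable `[a, b] (EFin \o f).
Proof.
move=> cf; apply: continuous_compact_integrable; first exact: segment_compact.
exact: continuous_subspaceT.
Qed.

(** The integrating factor exp (a t) removes the unknown from the integral:
    exp (a t) V t - int_0^t exp (a s) g s ds has derivative zero. *)
Lemma linear_ode_solution (R : realType) (a z : R) (V g : R -> R) :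
  continuous V -> continuous g ->
  (forall t : R, 0 <= t ->
     V t = z + \int[lebesgue_measure]_(s in `[0, t]) (g s - a * V s)) ->
  forall t : R, 0 <= t ->
    V t = expR (- a * t) *
      (z + \int[lebesgue_measure]_(s in `[0, t]) (expR (a * s) * g s)).
Proof.
move=> cV cg VE t; rewrite le_eqVlt => /predU1P[<-|t0].
  by rewrite VE// set_itv1 !Rintegral_set1 mulr0 expR0 mul1r.
pose h s := g s - a * V s; pose k s := expR (a * s) * g s.
have ch : continuous h.
  move=> s; apply: (@continuousB R R R g (fun s => a * V s)); first exact: cg.
  by apply: (@continuousM R R (fun=> a) V); [exact: cst_continuous|exact: cV].
have ck : continuous k.
  move=> s; apply: (@continuousM R R (fun s => expR (a * s)) g); last exact: cg.
  exact: continuous_expRM.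
pose H s := \int[lebesgue_measure]_(r in `[0, s]) h r.
pose K s := \int[lebesgue_measure]_(r in `[0, s]) k r.
have dH (s : R) : 0 < s -> is_derive s 1 H (h s).
  move=> s0; have [||dH' E] := @continuous_FTC1_closed R h 0 s (s + 1) _ _ s0 (ch s).
  - by rewrite ltrDl.
  - exact: continuous_integrable_itv.
  - by apply: DeriveDef => //; rewrite -E derive1E.
have dK (s : R) : 0 < s -> is_derive s 1 K (k s).
  move=> s0; have [||dK' E] := @continuous_FTC1_closed R k 0 s (s + 1) _ _ s0 (ck s).
  - by rewrite ltrDl.
  - exact: continuous_integrable_itv.
  - by apply: DeriveDef => //; rewrite -E derive1E.
pose Q s := expR (a * s) * (z + H s) - K s.
have dQ (s : R) : s \in `]0, t[%R -> is_derive s 1 Q 0.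
  rewrite in_itv/= => /andP[s0 _].
  have dHs := dH s s0; have dKs := dK s s0.
  have de : is_derive s 1 (fun s : R => expR (a * s)) (a * expR (a * s)).
    have da : is_derive s 1 (fun s : R => a * s) a.
      by apply: DeriveDef => //; rewrite -derive1E derive1Ml// derive1_id mulr1.
    have := @is_derive1_comp R expR (fun s : R => a * s) s _ _ (is_derive_expR _) da.
    by rewrite mulrC.
  have dz : is_derive s 1 (fun s : R => z + H s) (h s).
    have := @is_deriveD _ _ _ (cst z) H s 1 _ _ (is_derive_cst _ _ _) dHs.
    by rewrite add0r.
  have := @is_deriveB _ _ _ _ K s 1 _ _ (is_deriveM de dz) dKs.
  move=> /is_derive_eq; apply.
  rewrite /GRing.scale/= /k /h (VE s (ltW s0)) -/(H s) /h; ring.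
have cQ : {within `[0, t], continuous Q}.
  have cH : {within `[0, t], continuous H}.
    apply: parameterized_integral_continuous; first exact: ltW.
    exact: continuous_integrable_itv.
  have cK : {within `[0, t], continuous K}.
    apply: parameterized_integral_continuous; first exact: ltW.
    exact: continuous_integrable_itv.
  pose I := subspace (`[0, t]%classic : set R).
  move=> s; apply: (@continuousB R R I (fun s => expR (a * s) * (z + H s)) K);
    last exact: cK.
  apply: (@continuousM R I (fun s => expR (a * s)) (fun s => z + H s)).
    exact: (continuous_subspaceT (@continuous_expRM R a)).
  apply: (@continuousD R R I (fun=> z) H); last exact: cH.
  exact: cst_continuous.
have [c _] := MVT t0 dQ cQ.
rewrite mul0r => /eqP; rewrite subr_eq0 => /eqP; rewrite /Q.
have [H0 K0] : H 0 = 0 /\ K 0 = 0 by rewrite /H /K set_itv1 !Rintegral_set1.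
rewrite H0 K0 mulr0 expR0 mul1r addr0 subr0 => E.
rewrite (VE t (ltW t0)) -/(H t) -/(K t).
have -> : z + K t = expR (a * t) * (z + H t) by rewrite -{1}E subrK.
by rewrite mulrA -expRD mulNr addNr expR0 mul1r.
Qed.

(** * Monotonicity of the integral for arbitrary integrands *)

Section UnmeasuredIntegrands.
Import HBNNSimple.

(** The integral of a nonnegative function is a supremum over simple functions
    below it, which is monotone for any integrands; multiplying a simple function
    by the indicator of the complement of a null set does not change its integral,
    whence the almost-everywhere version.  This compares expected payoffs without
    first proving that payoffs are measurable. *)
Lemma ae_le_integral_unmeasured d (T : measurableType d) (R : realType)
    (mu : {measure set T -> \bar R}) (D : set T) (f g : T -> \bar R) :
  {ae mu, forall x, D x -> (f x <= g x)%E} ->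
  (\int[mu]_(x in D) f x <= \int[mu]_(x in D) g x)%E.
Proof.
move=> [N [mN N0 fgN]].
have ge0_case (u v : T -> \bar R) : (forall x, 0 <= u x)%E ->
    (forall x, 0 <= v x)%E -> (forall x, ~ N x -> (u x <= v x)%E) ->
    (\int[mu]_x u x <= \int[mu]_x v x)%E.
  move=> u0 v0 uv; rewrite !ge0_integralTE//; apply: ge_ereal_sup => _ [h hu <-].
  apply: le_ereal_sup_tmp.
  exists (sintegral mu (proj_nnsfun h (measurableC mN))); first last.
    rewrite -!integralT_nnsfun.
    rewrite (@ge0_negligible_integral _ _ _ _ setT N)//=.
    - rewrite setTD integral_mkcond.
      rewrite le_eqVlt; apply/orP; left; apply/eqP.
      apply: eq_integral => x _; rewrite patchE /= mindicE.
      by case: (x \in ~` N); rewrite ?mulr1 ?mulr0.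
    - by apply/measurable_EFinP.
    - by move=> x _; rewrite lee_fin; exact: fun_ge0.
  exists (proj_nnsfun h (measurableC mN)) => //= x.
  rewrite /= mindicE; case: (boolP (x \in ~` N)) => [|_]; last by rewrite mulr0.
  by rewrite inE mulr1 => Nx; exact: le_trans (hu x) (uv x Nx).
rewrite [leLHS]integralE [leRHS]integralE !(integral_mkcond D); apply: leeB.
  apply: ge0_case => [x|x|x Nx]; [by rewrite erestrict_ge0// => ? _;exact: funepos_ge0..|].
  rewrite !patchE; case: ifPn => // xD; apply: (@funepos_le _ _ [set x]).
    move=> y; rewrite inE => ->; move: xD; rewrite inE => xD.
    by apply: contrapT => fg; apply: Nx; apply: fgN => /= /(_ xD).
  by rewrite inE.
apply: ge0_case => [x|x|x Nx]; [by rewrite erestrict_ge0// => ? _;exact: funeneg_ge0..|].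
rewrite !patchE; case: ifPn => // xD; apply: (@funeneg_le _ _ [set x]).
  move=> y; rewrite inE => ->; move: xD; rewrite inE => xD.
  by apply: contrapT => fg; apply: Nx; apply: fgN => /= /(_ xD).
by rewrite inE.
Qed.

End UnmeasuredIntegrands.

(** * Discounted integrals up to a horizon *)

Definition horizon (R : realType) (sg : \bar R) : set R :=
  [set t : R | 0 <= t /\ (t%:E <= sg)%E].

(** The horizon is allowed to be infinite, since a stopping time may be. *)
Definition discounted (R : realType) (lam : R) (sg : \bar R) (h : R -> R) : \bar R :=
  (\int[lebesgue_measure]_(t in horizon sg) (expR (- lam * t) * h t)%:E)%E.

Lemma horizon_pinfty (R : realType) : horizon (+oo%E : \bar R) = `[0, +oo[%classic.
Proof.
by apply/seteqP; split=> t /=; rewrite in_itv/= andbT; [case|move=> t0; split; rewrite ?leey].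
Qed.

Lemma horizon_fin (R : realType) (r : R) : horizon r%:E = `[0, r]%classic.
Proof.
by apply/seteqP; split=> t /=; rewrite /horizon/= in_itv/= lee_fin; [case=> -> ->|move/andP].
Qed.

Lemma horizon_ninfty (R : realType) : horizon (-oo%E : \bar R) = set0.
Proof. by apply/seteqP; split=> t //=; rewrite /horizon/= => -[_]; rewrite leeNy_eq. Qed.

Lemma measurable_horizon (R : realType) (sg : \bar R) : measurable (horizon sg).
Proof.
case: sg => [r||]; rewrite ?horizon_fin ?horizon_pinfty ?horizon_ninfty//.
Qed.

Lemma discounted_ge0 (R : realType) (lam : R) sg (h : R -> R) :
  (forall t, 0 <= t -> 0 <= h t) -> (0 <= discounted lam sg h)%E.
Proof.
move=> h0; apply: integral_ge0 => t [t0 _].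
by rewrite lee_fin mulr_ge0 ?expR_ge0 ?h0.
Qed.

Lemma le_discounted (R : realType) (lam : R) sg (h k : R -> R) :
  (forall t, 0 <= t -> h t <= k t) ->
  (discounted lam sg h <= discounted lam sg k)%E.
Proof.
move=> hk; apply: ae_le_integral_unmeasured.
apply: aeW => t [t0 _]; rewrite lee_fin.
by apply: ler_wpM2l; [exact: expR_ge0|exact: hk].
Qed.

Lemma discountedD (R : realType) (lam : R) sg (h k : R -> R) :
  measurable_fun setT h -> measurable_fun setT k ->
  (forall t, 0 <= t -> 0 <= h t) -> (forall t, 0 <= t -> 0 <= k t) ->
  discounted lam sg (fun t => h t + k t) =
  (discounted lam sg h + discounted lam sg k)%E.
Proof.
move=> mh mk h0 k0; rewrite /discounted -ge0_integralD.
- by apply: eq_integral => t _; rewrite mulrDr EFinD.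
- exact: measurable_horizon.
- by move=> t [t0 _]; rewrite lee_fin mulr_ge0 ?expR_ge0 ?h0.
- apply/measurable_EFinP; apply: measurable_funM; first exact: measurable_expRM.
  exact: measurable_funTS.
- by move=> t [t0 _]; rewrite lee_fin mulr_ge0 ?expR_ge0 ?k0.
- apply/measurable_EFinP; apply: measurable_funM; first exact: measurable_expRM.
  exact: measurable_funTS.
Qed.

Lemma discountedZ (R : realType) (lam : R) sg (c : R) (h : R -> R) :
  measurable_fun setT h -> 0 <= c -> (forall t, 0 <= t -> 0 <= h t) ->
  discounted lam sg (fun t => c * h t) = (c%:E * discounted lam sg h)%E.
Proof.
move=> mh c0 h0; rewrite /discounted -ge0_integralZl_EFin//.
- by apply: eq_integral => t _; rewrite -EFinM mulrCA.
- exact: measurable_horizon.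
- by move=> t [t0 _]; rewrite lee_fin mulr_ge0 ?expR_ge0 ?h0.
- apply/measurable_EFinP; apply: measurable_funM; first exact: measurable_expRM.
  exact: measurable_funTS.
Qed.

Lemma integral_expR_tail (R : realType) (lam s : R) : 0 < lam ->
  (\int[lebesgue_measure]_(t in `[s, +oo[) (expR (- lam * t))%:E =
   (lam^-1 * expR (- lam * s))%:E)%E.
Proof.
move=> l0.
have dF (x : R) : is_derive x 1 (fun t : R => - lam^-1 * expR (- lam * t)) (expR (- lam * x)).
  have da : is_derive x 1 (fun s : R => - lam * s) (- lam).
    by apply: DeriveDef => //; rewrite -derive1E derive1Ml// derive1_id mulr1.
  have de := @is_derive1_comp R expR (fun s : R => - lam * s) x _ _ (is_derive_expR _) da.
  have := @is_deriveZ _ _ _ (expR \o (fun s : R => - lam * s)) (- lam^-1) x 1 _ de.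
  move=> /is_derive_eq; apply.
  by rewrite /GRing.scale/= mulrCA mulrNN mulVf ?mulr1// gt_eqF.
rewrite (@ge0_continuous_FTC2y R _ (fun t => - lam^-1 * expR (- lam * t)) s 0).
- by rewrite sub0e -EFinN mulNr opprK.
- by move=> x _; exact: expR_ge0.
- exact/continuous_subspaceT/continuous_expRM.
- rewrite -[0 in X in _ --> X](mulr0 (- lam^-1)).
  apply: cvgM; first exact: cvg_cst.
  rewrite (_ : (fun t => _) = (fun u => expR (- u)) \o (fun t => lam * t)); last first.
    by apply/funext => t; rewrite /= mulNr.
  apply: (@cvg_comp _ _ _ _ _ _ (pinfty_nbhs R)); last exact: cvgr_expR.
  exact: gt0_cvgMry.
- by move=> x _; have := dF x.
- apply: cvg_at_right_filter; apply: cvgM; first exact: cvg_cst.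
  exact: continuous_expRM.
- by move=> x _; rewrite derive1E; have [_ ->] := dF x.
Qed.

Lemma discounted_const1_pinfty (R : realType) (lam : R) : 0 < lam ->
  discounted lam +oo%E (fun=> 1) = lam^-1%:E.
Proof.
move=> l0; rewrite /discounted horizon_pinfty.
under eq_integral do rewrite mulr1.
by rewrite integral_expR_tail// mulr0 expR0 mulr1.
Qed.

Lemma discounted_const1_fin (R : realType) (lam r : R) : 0 < lam -> 0 <= r ->
  discounted lam r%:E (fun=> 1) = (lam^-1 * (1 - expR (- lam * r)))%:E.
Proof.
move=> l0 r0; have := discounted_const1_pinfty l0.
rewrite /discounted horizon_pinfty horizon_fin.
have mf D : measurable_fun D (fun t : R => (expR (- lam * t) * 1)%:E).
  by apply/measurable_EFinP; under eq_fun do rewrite mulr1; exact: measurable_expRM.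
have E : `[0, +oo[%classic = (`[0, r] `|` `]r, +oo[)%classic :> set R.
  by rewrite -itv_bndbnd_setU// bnd_simp.
rewrite E ge0_integral_setU//=.
- rewrite [X in (_ + X)%E]integral_itv_obnd_cbnd//.
  under [X in (_ + X)%E]eq_integral do rewrite mulr1.
  rewrite integral_expR_tail// => /eqP.
  rewrite eq_sym -sube_eq//; last by rewrite fin_num_adde_defl.
  by move=> /eqP <-; rewrite mulrBr mulr1 EFinB.
- exact: mf.
- apply/disj_setPS => t [] /=; rewrite !in_itv/= andbT => /andP[_ tr] rt.
  by move: (lt_le_trans rt tr); rewrite ltxx.
Qed.

(** By Fubini, the mass placed on h s is the integral of exp (- lam t) over the
    part of [s, +oo[ before the horizon, which is at most exp (- lam s) / lam. *)
Lemma discounted_running (R : realType) (lam : R) sg (h : R -> R) : 0 < lam ->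
  measurable_fun setT h -> (forall t, 0 <= h t) ->
  (forall t, lebesgue_measure.-integrable `[0, t] (EFin \o h)) ->
  (discounted lam sg (fun t => (\int[lebesgue_measure]_(s in `[0, t]) h s)%R) <=
   lam^-1%:E * discounted lam sg h)%E.
Proof.
move=> l0 mh h0 ih.
pose A : set (R * R) := [set z | horizon sg z.1 /\ (0 <= z.2 /\ z.2 <= z.1)].
have mA : measurable A.
  rewrite (_ : A = (fst @^-1` horizon sg) `&`
     ([set z | (cst 0 z <= snd z)%R] `&` [set z | snd z <= fst z])).
    apply: measurableI.
      by rewrite -[X in measurable X]setTI; apply: measurable_fst => //; exact: measurable_horizon.
    apply: measurableI.
      have := @measurable_fun_ler _ _ R setT (cst 0) (@snd R R) (measurable_cst _) measurable_snd measurableT [set true] I.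
      by rewrite setTI; congr measurable; apply/seteqP; split => z /=.
    have := @measurable_fun_ler _ _ R setT (@snd R R) (@fst R R) measurable_snd measurable_fst measurableT [set true] I.
    by rewrite setTI; congr measurable; apply/seteqP; split => z /=.
  by apply/seteqP; split.
pose phi (z : measurableTypeR R * measurableTypeR R) : \bar R := (\1_A z * (expR (- lam * z.1) * h z.2))%:E.
have mphi : measurable_fun setT phi.
  apply/measurable_EFinP; apply: measurable_funM; first exact: measurable_indic.
  apply: measurable_funM.
    apply: measurableT_comp => //; apply: measurable_funM => //.
  exact: measurableT_comp.
have phi0 z : (0 <= phi z)%E.
  by rewrite lee_fin !mulr_ge0// ?expR_ge0//.
have -> : discounted lam sg (fun t => (\int[lebesgue_measure]_(s in `[0, t]) h s)%R) =
    (\int[@lebesgue_measure R]_t \int[@lebesgue_measure R]_s phi (t, s))%E.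
  rewrite /discounted integral_mkcond; apply: eq_integral => t _.
  rewrite patchE; case: ifPn => [|tH]; last first.
    apply/esym/integral0_eq => s _; rewrite /phi indicE /= memNset ?mul0r//.
    by move=> [/= tH' _]; move/negP : tH; apply; exact: mem_set.
  rewrite inE => tH.
  rewrite EFinM fineK; last exact: integrable_fin_num (ih t).
  rewrite -integralZl//.
  rewrite integral_mkcond; apply: eq_integral => s _; rewrite patchE.
  rewrite /phi/= indicE; case: ifPn => st.
    rewrite mem_set ?mul1r ?EFinM//; move: st; rewrite inE/= in_itv/= => /andP[s0 st].
    by split => //.
  rewrite memNset ?mul0r// => -[/= _ [s0 st']]; move/negP : st; apply.
  by rewrite inE/= in_itv/= s0 st'.
rewrite fubini_tonelli//.
rewrite /discounted -ge0_integralZl_EFin; last 4 first.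
- exact: measurable_horizon.
- by move=> t [t0 _]; rewrite lee_fin mulr_ge0 ?expR_ge0 ?h0.
- apply/measurable_EFinP; apply: measurable_funM; first exact: measurable_expRM.
  exact: measurable_funTS.
- by rewrite invr_ge0 ltW.
rewrite [leRHS]integral_mkcond; apply: ae_le_integral_unmeasured.
apply: aeW => s _; rewrite patchE; case: ifPn => [|sH]; last first.
  rewrite integral0_eq// => t _; rewrite /phi indicE /= memNset ?mul0r//.
  move=> [/= [t0 tsg] [s0 st]]; move/negP : sH; apply; rewrite inE; split => //.
  by apply: le_trans tsg; rewrite lee_fin.
rewrite inE => -[s0 ssg].
rewrite -EFinM mulrA EFinM -integral_expR_tail// -ge0_integralZr//; last 2 first.
- by apply/measurable_EFinP; exact: measurable_expRM.
- by rewrite lee_fin.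
rewrite [leRHS]integral_mkcond; apply: ae_le_integral_unmeasured.
apply: aeW => t _; rewrite patchE /phi indicE/=; case: ifPn => tH.
  rewrite -EFinM lee_fin; apply: ler_piMl; first by rewrite mulr_ge0 ?expR_ge0.
  by case: (_ \in A).
rewrite memNset ?mul0r// => -[/= _ [_ st]]; move/negP : tH; apply.
by rewrite inE/= in_itv/= st.
Qed.

Lemma continuous_normr (R : realType) (f : R -> R) :
  continuous f -> continuous (fun t => `|f t|).
Proof. by move=> cf t; apply: continuous_comp; [exact: cf|exact: norm_continuous]. Qed.

Lemma continuous_scale (R : realType) (c : R) (f : R -> R) :
  continuous f -> continuous (fun t => c * f t).
Proof.
move=> cf t; apply: (@continuousM R R (fun=> c) f); [exact: cst_continuous|exact: cf].
Qed.

(** The noise v is subtracted before solving, since it is only continuous;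
    the price is the source term - a v. *)
Lemma linear_ode_bound (R : realType) (a z : R) (Z f v : R -> R) : 0 <= a ->
  continuous Z -> continuous f -> continuous v ->
  (forall t : R, 0 <= t ->
     Z t = z + \int[lebesgue_measure]_(s in `[0, t]) (f s - a * Z s) + v t) ->
  forall t : R, 0 <= t -> `|Z t - z * expR (- a * t)| <=
    `|v t| + \int[lebesgue_measure]_(s in `[0, t]) (`|f s| + a * `|v s|).
Proof.
move=> a0 cZ cf cv ZE t t0.
pose g s := f s - a * v s.
have cg : continuous g.
  by move=> s; apply: (@continuousB R R R f); [exact: cf|exact: continuous_scale].
have cV : continuous (fun s => Z s - v s).
  by move=> s; apply: (@continuousB R R R Z v); [exact: cZ|exact: cv].
have := @linear_ode_solution R a z (fun s => Z s - v s) g cV cg _ t t0.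
have -> : (forall t : R, 0 <= t -> Z t - v t = z +
    \int[lebesgue_measure]_(s in `[0, t]) (g s - a * (Z s - v s))) = True.
  apply/propext; split => // _ s s0; rewrite ZE// addrK; congr (_ + _).
  by apply: eq_Rintegral => r _; rewrite /g; ring.
move=> /(_ I) E.
have -> : Z t - z * expR (- a * t) = v t + expR (- a * t) *
    \int[lebesgue_measure]_(s in `[0, t]) (expR (a * s) * g s).
  by apply: (@addIr _ (- v t)); rewrite addrAC E; ring.
apply: le_trans (ler_normD _ _) _; rewrite lerD2l.
rewrite normrM (ger0_norm (expR_ge0 _)).
have ik : lebesgue_measure.-integrable `[0, t] (EFin \o (fun s : R => expR (a * s) * g s)).
  apply: continuous_integrable_itv => s.
  by apply: (@continuousM R R (fun s => expR (a * s)) g); [exact: continuous_expRM|exact: cg].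
have cb : continuous (fun s => `|f s| + a * `|v s|).
  move=> s; apply: (@continuousD R R R (fun s => `|f s|) (fun s => a * `|v s|)).
    exact: continuous_normr.
  by apply: continuous_scale; exact: continuous_normr.
have ib := @continuous_integrable_itv R _ 0 t cb.
apply: (@le_trans _ _ (expR (- a * t) * \int[lebesgue_measure]_(s in `[0, t])
    (expR (a * t) * (`|f s| + a * `|v s|)))).
  apply: ler_wpM2l; first exact: expR_ge0.
  apply: le_trans (le_normr_Rintegral _ ik) _ => //.
  apply: le_Rintegral => //.
  - exact: integrable_norm ik.
  - exact: (@continuous_integrable_itv R _ 0 t (continuous_scale cb)).
  - move=> s /=; rewrite in_itv/= => /andP[s0 st].
    rewrite normrM (ger0_norm (expR_ge0 _)); apply: ler_pM => //; rewrite ?expR_ge0//.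
    + by rewrite ler_expR ler_wpM2l.
    + by rewrite /g; apply: le_trans (ler_normB _ _) _; rewrite normrM (ger0_norm a0).
rewrite RintegralZl// mulrA -expRD mulNr addNr expR0 mul1r//.
Qed.

Lemma running_nondecreasing (R : realType) (k : R -> R) :
  measurable_fun setT k -> (forall t, 0 <= k t) ->
  (forall t, lebesgue_measure.-integrable `[0, t] (EFin \o k)) ->
  forall s t : R, s <= t ->
  \int[lebesgue_measure]_(r in `[0, s]) k r <= \int[lebesgue_measure]_(r in `[0, t]) k r.
Proof.
move=> mk k0 ik s t st; apply: fine_le.
- exact: integrable_fin_num (ik s).
- exact: integrable_fin_num (ik t).
apply: ge0_subset_integral => //.
- by apply/measurable_EFinP; exact: measurable_funTS.
- by move=> x _; rewrite lee_fin.
- by apply: subset_itvl; rewrite bnd_simp.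
Qed.

(** The discounted form keeps a bounded constant: the running integral on the
    right of [linear_ode_bound] costs 1 / lam instead of growing with time. *)
Lemma discounted_ode_bound (R : realType) (lam a z : R) (sg : \bar R) (Z f v : R -> R) :
  0 < lam -> 0 <= a -> continuous Z -> continuous f -> continuous v ->
  (forall t : R, 0 <= t ->
     Z t = z + \int[lebesgue_measure]_(s in `[0, t]) (f s - a * Z s) + v t) ->
  (discounted lam sg (fun t => `|Z t - z * expR (- a * t)|%R) <=
   (1 + a / lam)%:E * discounted lam sg (fun t => `|v t|%R) +
   lam^-1%:E * discounted lam sg (fun t => `|f t|%R))%E.
Proof.
move=> l0 a0 cZ cf cv ZE.
have cnv := continuous_normr cv; have cnf := continuous_normr cf.
have mv : measurable_fun setT (fun t => `|v t|) by exact: continuous_measurable_fun.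
have mf : measurable_fun setT (fun t => `|f t|) by exact: continuous_measurable_fun.
pose k t := `|f t| + a * `|v t|.
have ck : continuous k.
  move=> s; apply: (@continuousD R R R (fun s => `|f s|) (fun s => a * `|v s|)).
    exact: cnf.
  exact: continuous_scale.
have mk : measurable_fun setT k by exact: continuous_measurable_fun.
have k0 t : 0 <= k t by rewrite addr_ge0// mulr_ge0.
have ik t := @continuous_integrable_itv R _ 0 t ck.
have lk0 : (0 <= discounted lam sg k)%E by exact: discounted_ge0.
pose K t := \int[lebesgue_measure]_(s in `[0, t]) k s.
have K0 t : 0 <= t -> 0 <= K t by move=> _; apply: Rintegral_ge0.
have mK : measurable_fun setT K.
  by apply: nondecreasing_measurable => // s t st; exact: running_nondecreasing.
apply: le_trans (le_discounted _ _ (linear_ode_bound a0 cZ cf cv ZE)) _.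
rewrite discountedD//.
apply: (@le_trans _ _ (discounted lam sg (fun t => `|v t|%R) + lam^-1%:E * discounted lam sg k)%E).
  by rewrite leeD2l// discounted_running.
rewrite /k discountedD//; last 2 first.
  exact: measurable_funM.
  by move=> t _; rewrite mulr_ge0.
rewrite discountedZ//.
have v0 : (0 <= discounted lam sg (fun t => `|v t|%R))%E by exact: discounted_ge0.
have f0 : (0 <= discounted lam sg (fun t => `|f t|%R))%E by exact: discounted_ge0.
move: (discounted lam sg (fun t => `|v t|)) (discounted lam sg (fun t => `|f t|)) v0 f0.
move=> Nv Nf v0 f0.
rewrite ge0_muleDr//; last by rewrite mule_ge0.
rewrite EFinD ge0_muleDl//; last by rewrite lee_fin divr_ge0// ltW.
by rewrite mul1e -addeA muleA -EFinM [(lam^-1 * a)%R]mulrC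
  [((a / lam)%:E * _ + _)%E]addeC.
Qed.

(** * Comparison and size of the solutions along a path *)

(** The system along one outcome; the paths are taken continuous on the whole
    line, but the equations concern nonnegative times. *)
Definition sde_path (R : realType) (m b delta s1 s2 x y : R) (X Y W1 W2 : R -> R) : Prop :=
  [/\ continuous X, continuous Y,
     forall t : R, 0 <= t -> X t = x +
       \int[lebesgue_measure]_(s in `[0, t]) (Y s - delta * X s) + s1 * W1 t &
     forall t : R, 0 <= t -> Y t = y +
       \int[lebesgue_measure]_(s in `[0, t]) (m - b * Y s) + s2 * W2 t].

(** The noise cancels in the difference, so both components solve homogeneous
    linear equations once the coupling is removed by adding L times the second
    component to the first, with L = 1 / (b - delta). *)
Lemma sde_path_difference (R : realType) (m b delta s1 s2 x y x' y' : R)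
    (X Y X' Y' W1 W2 : R -> R) : delta != b ->
  sde_path m b delta s1 s2 x y X Y W1 W2 ->
  sde_path m b delta s1 s2 x' y' X' Y' W1 W2 ->
  forall t : R, 0 <= t -> X' t - X t =
    (x' - x + (y' - y) / (b - delta)) * expR (- delta * t) -
    (y' - y) / (b - delta) * expR (- b * t).
Proof.
move=> db [cX cY EX EY] [cX' cY' EX' EY'] t t0.
have bd : b - delta != 0 by rewrite subr_eq0 eq_sym.
pose L := (b - delta)^-1.
have c0 : continuous (fun _ : R => 0 : R) by exact: cst_continuous.
have cE : continuous (fun s => Y' s - Y s).
  by move=> s; apply: (@continuousB R R R Y' Y); [exact: cY'|exact: cY].
have ci (m' a : R) (f : R -> R) s : continuous f ->
    lebesgue_measure.-integrable `[0, s] (EFin \o (fun r => m' - a * f r)).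
  move=> cf; apply: continuous_integrable_itv => r.
  apply: (@continuousB R R R (fun=> m') (fun r => a * f r)); first exact: cst_continuous.
  exact: continuous_scale.
have hE (s : R) : 0 <= s -> Y' s - Y s = (y' - y) * expR (- b * s).
  move=> s0; rewrite (@linear_ode_solution R b (y' - y) (fun s => Y' s - Y s) (fun=> 0))//.
    under eq_Rintegral do rewrite mulr0.
    by rewrite Rintegral_cst// mul0r addr0 mulrC.
  move=> r r0; rewrite EY'// EY//.
  have -> : \int[lebesgue_measure]_(s in `[0, r]) (0 - b * (Y' s - Y s)) =
    \int[lebesgue_measure]_(s in `[0, r]) (m - b * Y' s) -
    \int[lebesgue_measure]_(s in `[0, r]) (m - b * Y s).
    rewrite -RintegralB//; [|exact: ci..].
    by apply: eq_Rintegral => u _; ring.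
  ring.
pose G s := (X' s - X s) + L * (Y' s - Y s).
have cG : continuous G.
  move=> s; apply: (@continuousD R R R (fun s => X' s - X s) (fun s => L * (Y' s - Y s))); last exact: continuous_scale.
  by apply: (@continuousB R R R X' X); [exact: cX'|exact: cX].
have hG : G t = (x' - x + (y' - y) * L) * expR (- delta * t).
  rewrite (@linear_ode_solution R delta (x' - x + (y' - y) * L) G (fun=> 0))//.
    under eq_Rintegral do rewrite mulr0.
    by rewrite Rintegral_cst// mul0r addr0 mulrC.
  move=> r r0; rewrite /G EY'// EY// EX'// EX//.
  have ciX (f g : R -> R) : continuous f -> continuous g ->
      lebesgue_measure.-integrable `[0, r] (EFin \o (fun s => g s - delta * f s)).
    move=> cf cg; apply: continuous_integrable_itv => s.
    by apply: (@continuousB R R R g (fun s => delta * f s)); [exact: cg|exact: continuous_scale].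
  have -> : \int[lebesgue_measure]_(s in `[0, r])
      (0 - delta * (X' s - X s + L * (Y' s - Y s))) =
    (\int[lebesgue_measure]_(s in `[0, r]) (Y' s - delta * X' s) -
    \int[lebesgue_measure]_(s in `[0, r]) (Y s - delta * X s)) + L *
    (\int[lebesgue_measure]_(s in `[0, r]) (m - b * Y' s) -
    \int[lebesgue_measure]_(s in `[0, r]) (m - b * Y s)).
    rewrite -!RintegralB//; [|exact: ci..|exact: ciX|exact: ciX].
    have iB : lebesgue_measure.-integrable `[0, r]
        (EFin \o (fun u => (m - b * Y' u) - (m - b * Y u))).
      exact: (integrableB _ (ci m b Y' r cY') (ci m b Y r cY)).
    rewrite -RintegralZl// -RintegralD//; last 2 first.
    - exact: (integrableB _ (ciX X' Y' cX' cY') (ciX X Y cX cY)).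
    - exact: (integrableZl _ L iB).
    by apply: eq_Rintegral => u _; rewrite /L; field.
  ring.
by have := hG; rewrite /G hE// => /(canRL (addrK _)) ->; rewrite /L; ring.
Qed.

(** In the formula of [sde_path_difference], the two exponentials are ordered
    because delta < b; the sign of y' - y decides which of the two
    hypotheses is used. *)
Lemma sde_path_comparison (R : realType) (m b delta s1 s2 x y x' y' : R)
    (X Y X' Y' W1 W2 : R -> R) : delta < b ->
  sde_path m b delta s1 s2 x y X Y W1 W2 ->
  sde_path m b delta s1 s2 x' y' X' Y' W1 W2 ->
  x <= x' -> 0 <= x' - x + (y' - y) / (b - delta) ->
  forall t : R, 0 <= t -> X t <= X' t.
Proof.
move=> db h h' xx' a0 t t0; rewrite -subr_ge0.
rewrite (sde_path_difference _ h h')//; last by rewrite lt_eqF.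
set B := (y' - y) / (b - delta) in a0 *.
have e : expR (- b * t) <= expR (- delta * t).
  by rewrite ler_expR !mulNr lerN2 ler_wpM2r// ltW.
have [B0|B0] := leP 0 B.
  rewrite subr_ge0; apply: ler_pM => //; rewrite ?expR_ge0//.
  by rewrite lerDr subr_ge0.
rewrite addr_ge0//; first by rewrite mulr_ge0// expR_ge0.
by rewrite -mulNr mulr_ge0 ?expR_ge0// oppr_ge0 ltW.
Qed.

(** Two applications of [discounted_ode_bound]: the first equation has Y as its
    source, and Y is bounded by the second equation. *)
Lemma sde_path_discounted_bound (R : realType) (m b delta s1 s2 x y lam : R) (sg : \bar R)
    (X Y W1 W2 : R -> R) : 0 < lam -> 0 < b -> 0 < delta -> 0 < s1 -> 0 < s2 ->
  continuous W1 -> continuous W2 ->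
  sde_path m b delta s1 s2 x y X Y W1 W2 ->
  (discounted lam sg (fun t => `|X t - x * expR (- delta * t)|%R) <=
   ((`|y| + `|m| / lam) / lam)%:E * discounted lam sg (fun=> 1%R) +
   ((s1 * (1 + delta / lam))%:E * discounted lam sg (fun t => `|W1 t|%R) +
   (s2 * (1 + b / lam) / lam)%:E * discounted lam sg (fun t => `|W2 t|%R)))%E.
Proof.
move=> l0 b0 d0 s10 s20 cW1 cW2 [cX cY EX EY].
have cs (c : R) (W : R -> R) : continuous W -> continuous (fun t => c * W t) by exact: continuous_scale.
have mW (W : R -> R) : continuous W -> measurable_fun setT (fun t => `|W t|).
  by move=> cW; apply: continuous_measurable_fun; exact: continuous_normr.
have NZ (c : R) (W : R -> R) : 0 < c -> continuous W ->
   discounted lam sg (fun t => `|c * W t|) = (c%:E * discounted lam sg (fun t => `|W t|%R))%E.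
  move=> c0 cW; rewrite -discountedZ//; [|exact: mW|exact: ltW].
  by congr discounted; apply/funext => t; rewrite normrM gtr0_norm.
have BX := discounted_ode_bound sg l0 (ltW d0) cX cY (cs s1 _ cW1) EX.
have cm : continuous (fun _ : R => m : R) by exact: cst_continuous.
have BY := discounted_ode_bound sg l0 (ltW b0) cY cm (cs s2 _ cW2) EY.
rewrite !NZ// in BX BY.
have Nm : discounted lam sg (fun=> `|m|) = (`|m|%:E * discounted lam sg (fun=> 1%R))%E.
  rewrite -discountedZ//; congr discounted; apply/funext => t.
  by rewrite mulr1.
rewrite Nm in BY.
have NY : (discounted lam sg (fun t => `|Y t|%R) <=
   discounted lam sg (fun t => `|Y t - y * expR (- b * t)|%R) +
   `|y|%:E * discounted lam sg (fun=> 1%R))%E.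
  rewrite -discountedZ// -discountedD//.
  - apply: le_discounted => t t0; rewrite mulr1.
    rewrite -{1}(subrK (y * expR (- b * t)) (Y t)).
    apply: le_trans (ler_normD _ _) _; rewrite lerD2l normrM.
    rewrite (ger0_norm (expR_ge0 _)); apply: ler_piMr => //.
    by rewrite expR_le1 mulNr oppr_le0 mulr_ge0// ltW.
  - apply: continuous_measurable_fun; apply: continuous_normr => s.
    apply: (@continuousB R R R Y (fun s => y * expR (- b * s))); first exact: cY.
    by apply: continuous_scale; exact: continuous_expRM.
apply: le_trans BX _.
have h1 : (0 <= discounted lam sg (fun=> 1%R))%E by exact: discounted_ge0.
have hW1 : (0 <= discounted lam sg (fun t => `|W1 t|%R))%E by exact: discounted_ge0.
have hW2 : (0 <= discounted lam sg (fun t => `|W2 t|%R))%E by exact: discounted_ge0.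
move: NY BY; move: h1 hW1 hW2.
move: (discounted _ _ (fun=> 1)) (discounted _ _ (fun t => `|W1 t|))
  (discounted _ _ (fun t => `|W2 t|)) (discounted _ _ (fun t => `|Y t|))
  (discounted _ _ (fun t => `|Y t - _|)) => N1 NW1 NW2 NY D h1 hW1 hW2 YD DB.
have {}YD : (NY <= ((1 + b / lam) * s2)%:E * NW2 + (`|y| + `|m| / lam)%:E * N1)%E.
  apply: (le_trans YD); apply: le_trans (leeD2r _ DB) _.
  rewrite [(`|y| + _)%:E]EFinD ge0_muleDl//; last by rewrite lee_fin divr_ge0// ltW.
  by rewrite EFinM !muleA -!EFinM (mulrC lam^-1) -addeA [X in (_ + X <= _)%E]addeC.
apply: (@le_trans _ _ (_ + lam^-1%:E * (((1 + b / lam) * s2)%:E * NW2 + (`|y| + `|m| / lam)%:E * N1))%E).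
  by apply: leeD2l; rewrite lee_pmul2l// lte_fin invr_gt0.
rewrite ge0_muleDr//; last 2 first.
- by rewrite mule_ge0// lee_fin mulr_ge0 ?ltW// addr_gt0// divr_gt0.
- by rewrite mule_ge0// lee_fin addr_ge0// divr_ge0// ltW.
rewrite !muleA -!EFinM.
rewrite [X in (_ <= X)%E]addeC -addeA.
rewrite [((1 + delta / lam) * s1)%R]mulrC [(lam^-1 * (`|y| + _))%R]mulrC.
by rewrite [(lam^-1 * _)%R]mulrC [((1 + b / lam) * s2)%R]mulrC.
Qed.

(** * Gaussian moments and independence *)

(** The Gaussian density is a version of the Radon-Nikodym derivative. *)
Lemma ge0_integral_normal_prob (R : realType) (m s : R) (f : R -> \bar R) :
  measurable_fun setT f -> (forall x, 0 <= f x)%E ->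
  (\int[normal_prob m s]_x f x =
   \int[lebesgue_measure]_x (f x * (normal_pdf m s x)%:E))%E.
Proof.
move=> mf f0; have dom := normal_prob_dominates m s.
pose rn := Radon_Nikodym_SigmaFinite.f (normal_prob m s) (@lebesgue_measure R).
have mpdf : measurable_fun setT (fun x => (normal_pdf m s x)%:E).
  by apply/measurable_EFinP; exact: measurable_normal_pdf.
have irn : lebesgue_measure.-integrable setT rn.
  exact: Radon_Nikodym_SigmaFinite.f_integrable.
have rnE : ae_eq lebesgue_measure setT rn (fun x => (normal_pdf m s x)%:E).
  apply: integral_ae_eq => // E _ mE.
  by rewrite -Radon_Nikodym_SigmaFinite.f_integral.
rewrite -(Radon_Nikodym_SigmaFinite.change_of_variables dom f0)//.
apply: ae_eq_integral => //.
- by apply: emeasurable_funM => //; exact: measurable_int irn.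
- by apply: emeasurable_funM.
- by case: rnE => N [mN N0 sub]; exists N; split => // x /= h; apply: sub => /= e;
    apply: h => _; rewrite -e.
Qed.

(** The constant is not optimal: x^2 is absorbed in the Gaussian density of
    twice the standard deviation, whose total mass is known. *)
Lemma normal_second_moment (R : realType) (s : R) : 0 < s ->
  (\int[normal_prob 0 s]_x (x ^+ 2)%:E <= (6 * s ^+ 2)%:E)%E.
Proof.
move=> s0.
have s0' : s != 0 by rewrite gt_eqF.
have s20' : 2 * s != 0 by rewrite mulf_neq0.
rewrite ge0_integral_normal_prob; last 2 first.
- by apply/measurable_EFinP; exact: measurable_funX.
- by move=> x; rewrite lee_fin sqr_ge0.
apply: (@le_trans _ _ (\int[lebesgue_measure]_x ((6 * s ^+ 2)%:E * (normal_pdf 0 (2 * s) x)%:E))%E).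
  apply: ae_le_integral_unmeasured; apply: aeW => x _.
  rewrite -!EFinM lee_fin !normal_pdfE//.
  have -> : normal_peak s = 2 * normal_peak (2 * s).
    rewrite /normal_peak (_ : (2 * s) ^+ 2 * pi *+ 2 = 2 ^+ 2 * (s ^+ 2 * pi *+ 2)).
      by rewrite sqrtrM// sqrtr_sqr ger0_norm// invfM mulrA divff// mul1r.
    ring.
  set p := normal_peak _.
  have p0 : 0 <= p by exact: normal_peak_ge0.
  rewrite /normal_fun subr0.
  pose u := x ^+ 2 / s ^+ 2.
  have -> : - x ^+ 2 / (s ^+ 2 *+ 2) = - u / 2 by rewrite /u; field.
  have -> : - x ^+ 2 / ((2 * s) ^+ 2 *+ 2) = - u / 8 by rewrite /u; field.
  have -> : x ^+ 2 = s ^+ 2 * u by rewrite /u mulrC divfK// expf_neq0.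
  (* x^2 is traded for the factor exp(3 u / 8) between the two densities. *)
  have : u <= 8 / 3 * expR (3 / 8 * u).
    have := expR_ge1Dx (3 / 8 * u); lra.
  have -> : - u / 8 = - u / 2 + 3 / 8 * u by field.
  rewrite expRD => h.
  have e0 := expR_ge0 (- u / 2); have e1 := expR_ge0 (3 / 8 * u).
  have q : 0 <= s ^+ 2 * p * expR (- u / 2) by rewrite mulr_ge0// mulr_ge0// sqr_ge0.
  apply: (@le_trans _ _ (s ^+ 2 * p * expR (- u / 2) * (2 * (8 / 3 * expR (3 / 8 * u))))).
    rewrite [leLHS](_ : _ = s ^+ 2 * p * expR (- u / 2) * (2 * u)); last by ring.
    by rewrite ler_wpM2l// ler_wpM2l.
  rewrite [leRHS](_ : _ = s ^+ 2 * p * expR (- u / 2) * (6 * expR (3 / 8 * u))); last by ring.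
  rewrite ler_wpM2l//; lra.
rewrite ge0_integralZl_EFin//.
- by rewrite integral_normal_pdf mule1.
- by move=> x _; rewrite lee_fin normal_pdf_ge0.
- by apply/measurable_EFinP; exact: measurable_normal_pdf.
- by rewrite mulr_ge0// sqr_ge0.
Qed.

Section IndependentLaws.
Context d (T : measurableType d) (R : realType) (P : probability T R).

(** Independence determines the joint law on rectangles, hence everywhere. *)
Lemma ge0_integral_independent (V D : {RV P >-> R}) (f : R * R -> \bar R) :
  (forall B C : set R, measurable B -> measurable C ->
     P ((V @^-1` B) `&` (D @^-1` C)) = P (V @^-1` B) * P (D @^-1` C))%E ->
  measurable_fun setT f -> (forall z, 0 <= f z)%E ->
  (\int[P]_w f (V w, D w) =
   \int[distribution P V \x distribution P D]_z f z)%E.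
Proof.
move=> ind mf f0.
have mVD : measurable_fun setT (fun w => (V w, D w)).
  by apply/measurable_fun_pairP; split; exact: measurable_funP.
pose VD : {RV P >-> (R * R)%type} := mfun_Sub (mem_set mVD).
transitivity (\int[distribution P VD]_z f z)%E.
  by rewrite ge0_integral_distribution.
apply: eq_measure_integral => A mA _; apply/esym.
exact: product_measure_unique.
Qed.

End IndependentLaws.

(** * Second moments of Brownian motion on past events *)

Section BrownianSecondMoment.
Context (R : realType) (d : measure_display) (Omega : measurableType d)
  (P : probability Omega R) (F : R -> set (set Omega)).

(** What the moment estimates use of one coordinate: the increments are
    independent of the past, and their law is Gaussian and symmetric, symmetry
    being recorded by giving the law of the opposite increment as well. *)
Definition scalar_brownian (W : R -> Omega -> R) : Prop :=
  [/\ adapted F W,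
      {ae P, forall w, W 0 w = 0},
      forall s t : R, 0 <= s -> s < t -> forall (A : set Omega) (C : set R),
        F s A -> measurable C ->
        P (A `&` [set w | C (W t w - W s w)]) =
        (P A * P [set w | C (W t w - W s w)%R])%E &
      forall s t : R, 0 <= s -> s < t -> forall B : set R, measurable B ->
        P [set w | B (W t w - W s w)] = normal_prob 0 (Num.sqrt (t - s)) B /\
        P [set w | B (- (W t w - W s w))] = normal_prob 0 (Num.sqrt (t - s)) B].

Hypothesis hF : complete_filtration P F.

Lemma filtration_measurable t A : 0 <= t -> F t A -> measurable A.
Proof. by case: hF => _ h _ _ t0; exact: h. Qed.

Lemma filtrationC t A : 0 <= t -> F t A -> F t (~` A).
Proof. by case: hF => h _ _ _ /h[_ C _] FA; rewrite -setTD; exact: C. Qed.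

Lemma filtrationU t A B : 0 <= t -> F t A -> F t B -> F t (A `|` B).
Proof.
case: hF => h _ _ _ /h[F0 C U] FA FB; rewrite -bigcup2E; apply: U => -[|[|]]//.
Qed.

Lemma filtrationI t A B : 0 <= t -> F t A -> F t B -> F t (A `&` B).
Proof.
move=> t0 FA FB; rewrite -(setCK (A `&` B)) setCI.
by apply: filtrationC => //; apply: filtrationU => //; exact: filtrationC.
Qed.

Variable W : R -> Omega -> R.
Hypothesis hW : scalar_brownian W.

Lemma measurable_brownian t : 0 <= t -> measurable_fun setT (W t).
Proof.
by case: hW => aW _ _ _ t0 _ B mB; rewrite setTI; apply: filtration_measurable (aW t t0 B mB).
Qed.

(** This is E [W_t^2; A] = E [W_s^2; A] + E [(W_t - W_s)^2] P A with a bound for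
    the variance.  The cross term is avoided by a reflection: with V = 1_A W_s and
    D = W_t - W_s, the pairs (V, D) and (V, - D) have the same law, so the
    parallelogram identity gives E [(V + D)^2] = E [V^2] + E [D^2], where all
    integrands are nonnegative. *)
Lemma increment_second_moment s t (A : set Omega) : 0 <= s -> s < t -> F s A ->
  (\int[P]_w (\1_A w * (W t w) ^+ 2)%:E <=
   \int[P]_w (\1_A w * (W s w) ^+ 2)%:E + (6 * (t - s))%:E * P A)%E.
Proof.
move=> s0 st FA.
have mA : measurable A := filtration_measurable s0 FA.
have t0 : 0 <= t by rewrite (le_trans s0)// ltW.
have mWs := measurable_brownian s0; have mWt := measurable_brownian t0.
have [aW _ ind law] := hW.
have m1 : measurable_fun setT (\1_A : Omega -> R) by exact: measurable_indic.
have mV : measurable_fun setT (fun w => \1_A w * W s w) by exact: measurable_funM.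
have mD : measurable_fun setT (fun w => W t w - W s w) by exact: measurable_funB.
have mD' : measurable_fun setT (fun w => - (W t w - W s w)) by exact: measurable_funN.
pose I : {RV P >-> R} := mfun_Sub (mem_set m1).
pose V : {RV P >-> R} := mfun_Sub (mem_set mV).
pose D : {RV P >-> R} := mfun_Sub (mem_set mD).
pose D' : {RV P >-> R} := mfun_Sub (mem_set mD').
have FV B : measurable B -> F s (V @^-1` B).
  move=> mB; have FC := filtrationC s0 FA.
  have -> : V @^-1` B = (A `&` (W s @^-1` B)) `|` (~` A `&` [set _ | B 0]).
    apply/seteqP; split => w /=; rewrite indicE.
      have [wA|wA] := boolP (w \in A); first by rewrite mul1r; left; split => //; exact: set_mem.
      by rewrite mul0r; right; split => //; move/negP : wA => h ?; apply: h; exact: mem_set.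
    by move=> [[wA Bw]|[wA Bw]]; [rewrite mem_set// mul1r|rewrite memNset// mul0r].
  apply: filtrationU => //; first by apply: filtrationI => //; exact: aW.
  have [B0|B0] := pselect (B 0).
    by rewrite (_ : [set _ | B 0] = setT) ?setIT//; apply/seteqP; split.
  rewrite (_ : [set _ | B 0] = set0) ?setI0//; last by apply/seteqP; split.
  by case: hF => h _ _ _; case: (h s s0).
have FI B : measurable B -> F s (I @^-1` B).
  move=> mB; have FC := filtrationC s0 FA.
  have F0 : F s set0 by case: hF => h _ _ _; case: (h s s0).
  have FT : F s setT by rewrite -setC0; exact: filtrationC.
  have -> : I @^-1` B = (A `&` [set _ | B 1]) `|` (~` A `&` [set _ | B 0]).
    apply/seteqP; split => w /=; rewrite indicE.
      have [wA|wA] := boolP (w \in A); first by left; split => //; exact: set_mem.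
      by right; split => //; move/negP : wA => h ?; apply: h; exact: mem_set.
    by move=> [[wA Bw]|[wA Bw]]; [rewrite mem_set|rewrite memNset].
  have Fc (Q : Prop) : F s [set _ : Omega | Q].
    have [q|q] := pselect Q.
      by rewrite (_ : [set _ | Q] = setT)//; apply/seteqP; split.
    by rewrite (_ : [set _ | Q] = set0)//; apply/seteqP; split.
  by apply: filtrationU => //; apply: filtrationI.
have PD B : measurable B -> P (D @^-1` B) = normal_prob 0 (Num.sqrt (t - s)) B.
  by move=> mB; have [] := law s t s0 st B mB.
have PD' B : measurable B -> P (D' @^-1` B) = normal_prob 0 (Num.sqrt (t - s)) B.
  by move=> mB; have [] := law s t s0 st B mB.
have indD Q C : F s Q -> measurable C -> P (Q `&` (D @^-1` C)) = (P Q * P (D @^-1` C))%E.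
  by move=> FQ mC; exact: ind.
have indD' Q C : F s Q -> measurable C -> P (Q `&` (D' @^-1` C)) = (P Q * P (D' @^-1` C))%E.
  move=> FQ mC; pose C' := (-%R @^-1` C : set R).
  have mC' : measurable C' by rewrite -[C']setTI; exact: (@measurable_funN _ _ R setT id).
  exact: (indD Q C' FQ mC').
have ED2 : (\int[P]_w ((D w) ^+ 2)%:E <= (6 * (t - s))%:E)%E.
  pose D0 : Omega -> measurableTypeR R := fun w => W t w - W s w.
  have mD0 : measurable_fun setT D0 by exact: mD.
  pose L : {RV P >-> measurableTypeR R} := mfun_Sub (mem_set mD0).
  have -> : (\int[P]_w ((D w) ^+ 2)%:E = \int[distribution P L]_x (x ^+ 2)%:E)%E.
    rewrite ge0_integral_distribution//.
    - by apply/measurable_EFinP; exact: measurable_funX.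
    - by move=> x; rewrite lee_fin sqr_ge0.
  have -> : (\int[distribution P L]_x (x ^+ 2)%:E =
      \int[normal_prob 0 (Num.sqrt (t - s))]_x (x ^+ 2)%:E)%E.
    by apply: eq_measure_integral => B mB _; exact: PD.
  rewrite -{2}(@sqr_sqrtr _ (t - s)); last by rewrite subr_ge0 ltW.
  by apply: normal_second_moment; rewrite sqrtr_gt0 subr_gt0.
have ms2 (f : Omega -> R) : measurable_fun setT f -> measurable_fun setT (fun w => (f w ^+ 2)%:E).
  by move=> mf; apply/measurable_EFinP; exact: measurable_funX.
have s20 (x : R) : (0 <= (x ^+ 2)%:E)%E by rewrite lee_fin sqr_ge0.
have refl : (\int[P]_w ((V w + D w) ^+ 2)%:E = \int[P]_w ((V w - D w) ^+ 2)%:E)%E.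
  pose f (z : R * R) : \bar R := ((z.1 + z.2) ^+ 2)%:E.
  have mf : measurable_fun setT f.
    by apply/measurable_EFinP; apply: measurable_funX; exact: measurable_funD.
  have f0 z : (0 <= f z)%E by exact: s20.
  rewrite (_ : (\int[P]_w ((V w - D w) ^+ 2)%:E = \int[P]_w f (V w, D' w))%E)//.
  rewrite (_ : (\int[P]_w ((V w + D w) ^+ 2)%:E = \int[P]_w f (V w, D w))%E)//.
  rewrite !ge0_integral_independent//; last 2 first.
  - by move=> B C mB mC; exact: (indD' _ _ (FV B mB) mC).
  - by move=> B C mB mC; exact: (indD _ _ (FV B mB) mC).
  rewrite !fubini_tonelli1//; apply: eq_integral => v _.
  apply: eq_measure_integral => B mB _.
  by rewrite /= /distribution /pushforward PD// PD'.
have EAD : (\int[P]_w (\1_A w * (D w) ^+ 2)%:E = P A * \int[P]_w ((D w) ^+ 2)%:E)%E.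
  pose f (z : R * R) : \bar R := (`|z.1| * z.2 ^+ 2)%:E.
  have mf : measurable_fun setT f.
    apply/measurable_EFinP; apply: measurable_funM.
      by apply: measurableT_comp => //; exact: measurable_fst.
    by apply: measurable_funX; exact: measurable_snd.
  have f0 z : (0 <= f z)%E by rewrite lee_fin mulr_ge0// sqr_ge0.
  transitivity (\int[P]_w f (I w, D w))%E.
    by apply: eq_integral => w _; rewrite /f/= ger0_norm// indicE; case: (_ \in _).
  rewrite ge0_integral_independent//; last first.
    by move=> B C mB mC; exact: (indD _ _ (FI B mB) mC).
  rewrite fubini_tonelli1//.
  transitivity (\int[distribution P I]_x (`|x|%:E * \int[P]_w ((D w) ^+ 2)%:E))%E.
    apply: eq_integral => x _; rewrite /fubini_F.
    have -> : (\int[P]_w ((D w) ^+ 2)%:E = \int[distribution P D]_x (x ^+ 2)%:E)%E.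
      rewrite ge0_integral_distribution//.
      by apply/measurable_EFinP; exact: measurable_funX.
    rewrite -ge0_integralZl_EFin//.
    by apply/measurable_EFinP; exact: measurable_funX.
  rewrite ge0_integralZr//; last 2 first.
  - by apply/measurable_EFinP; exact: normr_measurable.
  - by apply: integral_ge0 => w _; exact: s20.
  congr (_ * _)%E.
  rewrite ge0_integral_distribution//; last first.
    by apply/measurable_EFinP; exact: normr_measurable.
  transitivity (\int[P]_w (\1_A w)%:E)%E; last by rewrite integral_indic// setIT.
  by apply: eq_integral => w _ /=; rewrite ger0_norm// indicE; case: (_ \in _).
set X := (\int[P]_w (\1_A w * (W t w) ^+ 2)%:E)%E.
set S := (\int[P]_w (\1_A w * (W s w) ^+ 2)%:E)%E.
pose DA := (\int[P]_w (\1_A w * (D w) ^+ 2)%:E)%E.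
pose DN := (\int[P]_w (\1_(~` A) w * (D w) ^+ 2)%:E)%E.
have mi (B : set Omega) (f : Omega -> R) : measurable B -> measurable_fun setT f ->
    measurable_fun setT (fun w => (\1_B w * f w ^+ 2)%:E).
  move=> mB mf; apply/measurable_EFinP; apply: measurable_funM; first exact: measurable_indic.
  exact: measurable_funX.
have i0 (B : set Omega) (f : Omega -> R) w : (0 <= (\1_B w * f w ^+ 2)%:E)%E.
  by rewrite lee_fin mulr_ge0// sqr_ge0.
have mNA : measurable (~` A) by exact: measurableC.
have eVD : (\int[P]_w ((V w + D w) ^+ 2)%:E = X + DN)%E.
  rewrite -ge0_integralD//; [|exact: mi..].
  apply: eq_integral => w _; rewrite -EFinD; congr EFin.
  rewrite /= !indicE in_setC; case: (w \in A) => /=; ring.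
have eD : (\int[P]_w ((D w) ^+ 2)%:E = DA + DN)%E.
  rewrite -ge0_integralD//; [|exact: mi..].
  apply: eq_integral => w _; rewrite -EFinD; congr EFin.
  rewrite /= !indicE in_setC; case: (w \in A) => /=; ring.
have par : (2%:E * (X + DN) = 2%:E * (S + (DA + DN)))%E.
  rewrite -eVD -eD.
  transitivity (\int[P]_w ((V w + D w) ^+ 2)%:E + \int[P]_w ((V w - D w) ^+ 2)%:E)%E.
    by rewrite -refl mule_natl mule2n.
  have mVpD : measurable_fun setT (fun w => V w + D w) by exact: measurable_funD.
  have mVmD : measurable_fun setT (fun w => V w - D w) by exact: measurable_funB.
  rewrite -ge0_integralD//; [|exact: ms2..].
  rewrite -ge0_integralD//; [|exact: mi|exact: ms2].
  rewrite -ge0_integralZl_EFin//; last 2 first.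
  - by move=> w _; rewrite adde_ge0.
  - by apply: emeasurable_funD; [exact: mi|exact: ms2].
  apply: eq_integral => w _; rewrite -!EFinD -EFinM; congr EFin.
  rewrite /= !indicE; case: (w \in A) => /=; ring.
have DNfin : DN \is a fin_num.
  rewrite ge0_fin_numE; last by apply: integral_ge0.
  apply: le_lt_trans (ltry (6 * (t - s))); apply: le_trans ED2.
  by rewrite eD leeDr//; apply: integral_ge0.
have : (X + DN <= S + (DA + DN))%E.
  by rewrite -(@lee_pmul2l _ 2%:E)// par.
rewrite addeA leeD2rE// => /le_trans; apply; apply: leeD2l.
by rewrite /DA EAD muleC; apply: lee_wpmul2r.
Qed.

End BrownianSecondMoment.

(** * Continuous processes and the order of integration *)

(** The process is the limit of its discretisations along floor (t n) / n, each
    of which is measurable piece by piece. *)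
Lemma measurable_continuous_process (R : realType) d (T : measurableType d) (Z : R -> T -> R) :
  (forall t, measurable_fun setT (Z t)) ->
  (forall w, continuous (fun t => Z t w)) ->
  measurable_fun setT (fun z : measurableTypeR R * T => Z z.1 z.2).
Proof.
move=> mZ cZ.
pose g (n : nat) (t : R) : R := (Num.floor (t * n.+1%:R))%:~R / n.+1%:R.
apply: (@measurable_fun_cvg _ _ _ setT (fun n z => Z (g n z.1) z.2)); last first.
  move=> [t w] _ /=; apply: (cvg_comp (g ^~ t) (fun u => Z u w)); last exact: cZ.
  apply: (@squeeze_cvgr _ _ _ _ (fun n => t - n.+1%:R^-1) (fun=> t)).
  - near=> n; rewrite /g.
    have n0 : (0 : R) < n.+1%:R by [].
    rewrite ler_pdivrMr// floor_le andbT ler_pdivlMr// mulrBl mulVf ?gt_eqF//.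
    by have := floorD1_gt (t * n.+1%:R); rewrite intrD; lra.
  - rewrite -[X in _ --> X]subr0; apply: cvgB; first exact: cvg_cst.
    exact: cvg_harmonic.
  - exact: cvg_cst.
move=> n _ B mB; rewrite setTI.
have -> : (fun z : measurableTypeR R * T => Z (g n z.1) z.2) @^-1` B =
    \bigcup_(k in [set: int])
      ([set t : R | Num.floor (t * n.+1%:R) = k] `*` (Z (k%:~R / n.+1%:R) @^-1` B)).
  apply/seteqP; split => [[t w] /= Bz|[t w] [k _] [/= <-]//].
  by exists (Num.floor (t * n.+1%:R)).
apply: countable_bigcupT_measurable => // k.
apply: measurableX; last by rewrite -[X in measurable X]setTI; exact: mZ.
have -> : [set t : R | Num.floor (t * n.+1%:R) = k] =
    `[k%:~R / n.+1%:R, (k + 1)%:~R / n.+1%:R[%classic.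
  apply/seteqP; split => t /=; rewrite in_itv/= ler_pdivrMr// ltr_pdivlMr//.
    by move=> /eqP; rewrite floor_eq.
  by move=> h; apply/eqP; rewrite floor_eq.
exact: measurable_itv.
Unshelve. all: by end_near. Qed.

Section StoppedTonelli.
Context (R : realType) (d : measure_display) (Omega : measurableType d)
  (P : probability Omega R).
Variables (lam : R) (sg : Omega -> \bar R) (h : R -> Omega -> R).
Hypothesis msg : measurable_fun setT sg.
Hypothesis mh : measurable_fun setT (fun z : measurableTypeR R * Omega => h z.1 z.2).
Hypothesis h0 : forall t w, 0 <= h t w.

Let A : set (measurableTypeR R * Omega) := [set z | horizon (sg z.2) z.1].

Let mA : measurable A.
Proof.
rewrite (_ : A = [set z | 0 <= z.1] `&` [set z | ((z.1)%:E <= sg z.2)%E]); last first.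
  by apply/seteqP; split.
apply: measurableI.
  have := @measurable_fun_ler _ _ R setT (cst 0) (@fst (measurableTypeR R) Omega) (measurable_cst _) measurable_fst measurableT [set true] I.
  by rewrite setTI; congr measurable; apply/seteqP; split => z /=.
rewrite -[X in measurable X]setTI; apply: measurable_lee => //.
  by apply/measurable_EFinP; exact: measurable_fst.
exact: (measurableT_comp msg measurable_snd).
Qed.

Let phi (z : measurableTypeR R * Omega) : \bar R :=
  (\1_A z * (expR (- lam * z.1) * h z.1 z.2))%:E.

Let mphi : measurable_fun setT phi.
Proof.
apply/measurable_EFinP; apply: measurable_funM; first exact: measurable_indic.
apply: measurable_funM => //.
apply: measurableT_comp => //; apply: measurable_funM => //.
Qed.

Let phi0 z : (0 <= phi z)%E.
Proof. by rewrite lee_fin !mulr_ge0// expR_ge0. Qed.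

Let discountedE w : discounted lam (sg w) (h^~ w) = (\int[lebesgue_measure]_t phi (t, w))%E.
Proof.
rewrite /discounted integral_mkcond; apply: eq_integral => t _.
rewrite patchE /phi indicE /=; case: ifPn => tw.
  by rewrite mem_set ?mul1r//; move: tw; rewrite inE.
by rewrite memNset ?mul0r// => Atw; move/negP : tw; apply; exact: mem_set.
Qed.

Lemma measurable_discounted : measurable_fun setT (fun w => discounted lam (sg w) (h^~ w)).
Proof.
under eq_fun do rewrite discountedE.
exact: (@measurable_fun_fubini_tonelli_G _ _ _ _ R (@lebesgue_measure R) phi).
Qed.

(** Exchanging the expectation with the time integral turns the random horizon
    into the event that it has not been reached. *)
Lemma discounted_tonelli :
  (\int[P]_w discounted lam (sg w) (h^~ w) =
   \int[lebesgue_measure]_(t in `[0%R, +oo[)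
     ((expR (- lam * t))%:E *
      \int[P]_w (\1_[set w | (t%:E <= sg w)%E] w * h t w)%:E))%E.
Proof.
under eq_integral do rewrite discountedE.
rewrite -(@fubini_tonelli _ _ _ _ R lebesgue_measure P phi)//.
rewrite [RHS]integral_mkcond; apply: eq_integral => t _; rewrite patchE.
case: ifPn => t0; last first.
  apply: integral0_eq => w _; rewrite /phi indicE memNset ?mul0r// => -[/= t0' _].
  by move/negP : t0; apply; rewrite inE/= in_itv/= t0'.
have {}t0 : 0 <= t by move: t0; rewrite inE/= in_itv/= andbT.
have mt : measurable_fun setT (fun w => h t w).
  exact: (measurableT_comp mh (measurable_pair1 _)).
have mS : measurable [set w | (t%:E <= sg w)%E].
  by rewrite -[X in measurable X]setTI; apply: measurable_lee.
rewrite -ge0_integralZl_EFin//; last 2 first.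
- by move=> w _; rewrite lee_fin mulr_ge0.
- by apply/measurable_EFinP; apply: measurable_funM.
apply: eq_integral => w _; rewrite -EFinM /phi !indicE/=; congr EFin.
have -> : ((t, w) \in A) = (w \in [set w | (t%:E <= sg w)%E]).
  by apply/idP/idP; rewrite !inE => //; case.
by rewrite mulrCA.
Qed.

End StoppedTonelli.

(** If f grows over [s, t] by at most the left rectangle of a nonincreasing p,
    then f is below the integral q of p: along a uniform subdivision of mesh h,
    left and right rectangles differ by at most h (p 0 - p t). *)
Lemma left_riemann_bound (R : realType) (M : R) (f p q : R -> R) :
  (forall t, 0 <= t -> 0 <= p t <= M) -> f 0 <= q 0 ->
  (forall s t, 0 <= s -> s < t -> f t <= f s + (t - s) * p s) ->
  (forall s t, 0 <= s -> s <= t -> (t - s) * p t <= q t - q s) ->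
  forall t, 0 <= t -> f t <= q t.
Proof.
move=> pM fq0 fD qD t; rewrite le_eqVlt => /predU1P[<-//|t0].
have step (h : R) : 0 < h -> forall k, f (k%:R * h) <= q (k%:R * h) + h * (p 0 - p (k%:R * h)).
  move=> h0; elim=> [|k IH]; first by rewrite !mul0r subrr mulr0 addr0.
  have k0 : 0 <= k%:R * h by rewrite mulr_ge0// ltW.
  have kk : k.+1%:R * h = k%:R * h + h by rewrite -natr1 mulrDl mul1r.
  have lk : k%:R * h < k.+1%:R * h by rewrite kk ltrDl.
  have e : k.+1%:R * h - k%:R * h = h by rewrite kk addrAC subrr add0r.
  have := fD _ _ k0 lk; have := qD _ _ k0 (ltW lk); rewrite e => h1 h2.
  lra.
apply/ler_addgt0Pr => e e0.
have M0 : 0 <= M by have /andP[] := pM 0 (lexx _); exact: le_trans.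
(* With n steps the error of the induction is at most t M / n. *)
pose n := (Num.trunc (t * M / e)).+1.
have n0 : (0 : R) < n%:R by rewrite ltr0n.
have := step (t / n%:R) (divr_gt0 t0 n0) n.
rewrite mulrC divfK ?gt_eqF// => /le_trans; apply; rewrite lerD2l.
have /andP[p0 pM0] := pM 0 (lexx _); have /andP[pt _] := pM t (ltW t0).
apply: (@le_trans _ _ (t / n%:R * M)).
  by apply: ler_wpM2l; [rewrite divr_ge0// ltW|lra].
rewrite mulrAC ler_pdivrMr// -ler_pdivrMl// mulrC.
by rewrite ltW//; exact: truncnS_gt.
Qed.

(** * Discounted moments up to a stopping time *)

Section StoppedMoments.
Context (R : realType) (d : measure_display) (Omega : measurableType d)
  (P : probability Omega R) (F : R -> set (set Omega)).
Variables (Z : R -> Omega -> R) (sg : Omega -> \bar R).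
Hypothesis hF : complete_filtration P F.
Hypothesis mZ : forall t, measurable_fun setT (Z t).
Hypothesis cZ : forall w, continuous (fun t => Z t w).
Hypothesis Z0 : (\int[P]_w ((Z 0%R w) ^+ 2)%:E = 0)%E.
Hypothesis incrZ : forall (s t : R) (A : set Omega), 0 <= s -> s < t -> F s A ->
  (\int[P]_w (\1_A w * (Z t w) ^+ 2)%:E <=
   \int[P]_w (\1_A w * (Z s w) ^+ 2)%:E + (6 * (t - s))%:E * P A)%E.
Hypothesis msg : measurable_fun setT sg.
Hypothesis Fsg : forall t, 0 <= t -> F t [set w | (sg w <= t%:E)%E].

Let B (t : R) := [set w | (t%:E <= sg w)%E].
Let p (t : R) : R := fine (P (B t)).

Let mB t : measurable (B t).
Proof. by rewrite -[B t]setTI; apply: measurable_lee. Qed.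

Let p_itv t : 0 <= p t <= 1.
Proof.
rewrite /p fine_ge0//= -lee_fin fineK ?fin_num_measure//.
exact: probability_le1.
Qed.

Let p_noninc : nonincreasing_fun p.
Proof.
move=> s t st; apply: fine_le; rewrite ?fin_num_measure//.
apply: le_measure; rewrite ?inE; [exact: mB|exact: mB|].
move=> w; rewrite /B /=; apply: le_trans; by rewrite lee_fin.
Qed.

Let mp : measurable_fun setT p.
Proof. exact: nonincreasing_measurable. Qed.

Let ip (t : R) : lebesgue_measure.-integrable `[0, t] (EFin \o p).
Proof.
apply: measurable_bounded_integrable => //.
- by rewrite /= lebesgue_measure_itv; case: ifP => _; rewrite ?ltry// -EFinB ltry.
- exact: measurable_funTS.
- exists 1; split => // M M1 s _ /=; have /andP[p0 p1] := p_itv s.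
  by rewrite ger0_norm// (le_trans p1)// ltW.
Qed.

Let G (t : R) : \bar R := (\int[P]_w (\1_(B t) w * (Z t w) ^+ 2)%:E)%E.

Let mi (A : set Omega) t : measurable A ->
  measurable_fun setT (fun w => (\1_A w * (Z t w) ^+ 2)%:E).
Proof.
move=> mA; apply/measurable_EFinP; apply: measurable_funM; first exact: measurable_indic.
exact: measurable_funX.
Qed.

Let G_ge0 t : (0 <= G t)%E.
Proof. by apply: integral_ge0 => w _; rewrite lee_fin mulr_ge0// sqr_ge0. Qed.

Let le_indic (A C : set Omega) t : A `<=` C ->
  (\int[P]_w (\1_A w * (Z t w) ^+ 2)%:E <= \int[P]_w (\1_C w * (Z t w) ^+ 2)%:E)%E.
Proof.
move=> AC; apply: ae_le_integral_unmeasured; apply: aeW => w _.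
rewrite lee_fin; apply: ler_wpM2r; first exact: sqr_ge0.
rewrite !indicE; have [wA|//] := boolP (w \in A).
by rewrite mem_set//; apply: AC; exact: set_mem.
Qed.

Let G_step (s t : R) : 0 <= s -> s < t -> (G t <= G s + (6 * (t - s) * p s)%:E)%E.
Proof.
move=> s0 st; pose A := ~` [set w | (sg w <= s%:E)%E].
have FA : F s A by apply: (filtrationC hF) => //; exact: Fsg.
have AE w : A w -> (s%:E < sg w)%E by rewrite /A/= => /negP; rewrite -ltNge.
apply: (@le_trans _ _ (\int[P]_w (\1_A w * (Z t w) ^+ 2)%:E)%E).
  apply: le_indic => w; rewrite /B /A /= => tw; apply/negP; rewrite -ltNge.
  by apply: lt_le_trans tw; rewrite lte_fin.
apply: le_trans (incrZ s0 st FA) _; apply: leeD.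
  by apply: le_indic => w /AE /ltW.
rewrite [leRHS]EFinM /p fineK ?fin_num_measure//.
apply: lee_wpmul2l; first by rewrite lee_fin mulr_ge0// subr_ge0 ltW.
apply: le_measure; rewrite ?inE; [|exact: mB|by move=> w /AE /ltW].
exact: (filtration_measurable hF s0 FA).
Qed.

Let G0 : G 0 = 0%E.
Proof.
apply/eqP; rewrite eq_le G_ge0 andbT -Z0; apply: ae_le_integral_unmeasured.
apply: aeW => w _; rewrite lee_fin; apply: ler_piMl; first exact: sqr_ge0.
by rewrite indicE; case: (_ \in _).
Qed.

Let G_fin t : 0 <= t -> G t \is a fin_num.
Proof.
rewrite le_eqVlt => /predU1P[<-|t0]; first by rewrite G0.
rewrite ge0_fin_numE//; apply: le_lt_trans (G_step (lexx 0) t0) _.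
by rewrite G0 add0e ltry.
Qed.

(** The event s < sg belongs to the past of s, so [increment_second_moment]
    applies to it; it lies between the events t <= sg and s <= sg. *)
Lemma stopped_second_moment t : 0 <= t ->
  (\int[P]_w (\1_(B t) w * (Z t w) ^+ 2)%:E <=
   (6 * \int[lebesgue_measure]_(s in `[0%R, t]) p s)%:E)%E.
Proof.
move=> t0; rewrite -/(G t) -(fineK (G_fin t0)) lee_fin.
apply: (@left_riemann_bound _ 6 (fine \o G) (fun t => 6 * p t)
  (fun t => 6 * \int[lebesgue_measure]_(s in `[0, t]) p s)) t0.
- move=> s _; have /andP[p0 p1] := p_itv s; apply/andP; split; lra.
- by rewrite /= G0 set_itv1 Rintegral_set1 mulr0.
- move=> s u s0 su /=; have u0 : 0 <= u := le_trans s0 (ltW su).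
  have := G_step s0 su; rewrite -(fineK (G_fin u0)) -(fineK (G_fin s0)) lee_fin.
  by rewrite -!mulrA [(u - s) * (6 * _)]mulrCA.
- move=> s u s0 su; rewrite mulrCA -mulrBr ler_wpM2l//.
  rewrite (@Rintegral_itvB _ p (BLeft 0) (BRight u) s)//; [|exact: ip..].
  have isu : lebesgue_measure.-integrable `]s, u] (EFin \o p).
    by apply: integrableS (ip u) => //; apply: subset_itvr; rewrite bnd_simp.
  apply: (@le_trans _ _ (\int[lebesgue_measure]_(r in `]s, u]) p u)).
    rewrite Rintegral_cst//= mulrC lebesgue_measure_itv/= lte_fin.
    by case: ltP => // us; rewrite (_ : u = s) ?subrr//; apply/eqP; rewrite eq_le us su.
  have icst : lebesgue_measure.-integrable `]s, u] (EFin \o (fun _ : R => p u)).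
    have cc : continuous (fun _ : R => p u) by exact: cst_continuous.
    apply: integrableS (@continuous_integrable_itv R _ s u cc) => //.
    by apply: subset_itvr; rewrite bnd_simp.
  apply: le_Rintegral => //.
  + by move=> r /=; rewrite in_itv/= => /andP[_ ru]; exact: p_noninc.
Qed.

Let mZ2 : measurable_fun setT (fun z : measurableTypeR R * Omega => Z z.1 z.2).
Proof. exact: measurable_continuous_process. Qed.

Let mZsq : measurable_fun setT (fun z : measurableTypeR R * Omega => Z z.1 z.2 ^+ 2).
Proof. exact: measurable_funX. Qed.

Let mone : measurable_fun setT (fun _ : measurableTypeR R * Omega => 1 : R).
Proof. exact: measurable_cst. Qed.

Lemma discounted_second_moment (lam : R) : 0 < lam ->
  (\int[P]_w discounted lam (sg w) (fun t => (Z t w ^+ 2)%R) <=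
   (6 / lam)%:E * \int[P]_w discounted lam (sg w) (fun=> 1%R))%E.
Proof.
move=> l0.
rewrite (discounted_tonelli P lam msg mZsq); last by move=> *; exact: sqr_ge0.
rewrite (discounted_tonelli P lam msg mone)//.
pose q (t : R) := \int[lebesgue_measure]_(s in `[0, t]) p s.
have p0 t : 0 <= p t by have /andP[] := p_itv t.
have q0 t : 0 <= q t by apply: Rintegral_ge0.
have mq : measurable_fun setT q.
  by apply: nondecreasing_measurable => // s t st; exact: running_nondecreasing.
apply: (@le_trans _ _ (discounted lam +oo%E (fun t => 6 * q t))).
  rewrite /discounted horizon_pinfty; apply: ae_le_integral_unmeasured.
  apply: aeW => t; rewrite /= in_itv/= andbT => t0.
  rewrite EFinM; apply: lee_wpmul2l; first by rewrite lee_fin expR_ge0.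
  exact: stopped_second_moment.
rewrite discountedZ// EFinM -muleA.
apply: lee_wpmul2l => //; apply: le_trans (discounted_running _ l0 mp p0 ip) _.
apply: lee_wpmul2l; first by rewrite lee_fin invr_ge0 ltW.
rewrite /discounted horizon_pinfty; apply: ae_le_integral_unmeasured.
apply: aeW => t _; rewrite EFinM; apply: lee_wpmul2l; first by rewrite lee_fin expR_ge0.
under eq_integral do rewrite mulr1.
rewrite integral_indic; [|by []|exact: mB].
by rewrite setIT /p fineK// fin_num_measure.
Qed.

(** The elementary bound |z| <= r z^2 + 1 / (4 r) brings the first moment back
    to the second; the rate r^2 is the one that balances the two terms. *)
Lemma discounted_first_moment (r : R) : 0 < r ->
  (\int[P]_w discounted (r ^+ 2) (sg w) (fun t => `|Z t w|%R) <=
   (7 / r)%:E * \int[P]_w discounted (r ^+ 2) (sg w) (fun=> 1%R))%E.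
Proof.
move=> r0; have l0 : 0 < r ^+ 2 by rewrite exprn_gt0.
have mD (h : R -> Omega -> R) : measurable_fun setT (fun z : measurableTypeR R * Omega => h z.1 z.2) ->
   (forall t w, 0 <= h t w) ->
   measurable_fun setT (fun w => discounted (r ^+ 2) (sg w) (h ^~ w)).
  by move=> mh h0; exact: measurable_discounted.
have m2 := mD (fun t w => Z t w ^+ 2) mZsq (fun _ _ => sqr_ge0 _).
have m1 := mD (fun t w => 1) mone (fun _ _ => ler01).
have d2 w : (0 <= discounted (r ^+ 2) (sg w) (fun t => (Z t w ^+ 2)%R))%E.
  by apply: discounted_ge0 => *; exact: sqr_ge0.
have d1 w : (0 <= discounted (r ^+ 2) (sg w) (fun t => 1%R))%E by exact: discounted_ge0.
have r4 : 0 <= (4 * r)^-1 by rewrite invr_ge0 mulr_ge0// ltW.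
apply: (@le_trans _ _ (\int[P]_w (r%:E * discounted (r ^+ 2) (sg w) (fun t => (Z t w ^+ 2)%R)
   + ((4 * r)^-1)%:E * discounted (r ^+ 2) (sg w) (fun=> 1%R)))%E).
  apply: ae_le_integral_unmeasured; apply: aeW => w _.
  have mzw : measurable_fun setT (fun t => Z t w ^+ 2).
    by apply: measurable_funX; apply: continuous_measurable_fun; exact: cZ.
  have m4 : measurable_fun setT (fun t => r * Z t w ^+ 2) by exact: measurable_funM.
  rewrite -(discountedZ _ _ mzw (ltW r0) (fun t _ => sqr_ge0 (Z t w))).
  have mc : measurable_fun setT (fun _ : R => 1 : R) by exact: measurable_cst.
  rewrite -(discountedZ _ _ mc r4 (fun _ _ => ler01)).
  rewrite -discountedD//; last 2 first.
  - by move=> *; rewrite mulr_ge0// ?sqr_ge0// ltW.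
  - by move=> *; rewrite mulr1.
  apply: le_discounted => t _; rewrite mulr1.
  rewrite -[Z t w ^+ 2]real_normK ?num_real//.
  set a := `|Z t w|.
  have -> : r * a ^+ 2 + (4 * r)^-1 = a + (2 * r * a - 1) ^+ 2 * (4 * r)^-1.
    by field; rewrite gt_eqF.
  by rewrite lerDl mulr_ge0// sqr_ge0.
rewrite ge0_integralD//; last 4 first.
- by move=> w _; rewrite mule_ge0// lee_fin ltW.
- exact: measurable_funeM.
- by move=> w _; rewrite mule_ge0.
- exact: measurable_funeM.
rewrite !ge0_integralZl_EFin//; last exact: ltW.
apply: le_trans (leeD2r _ (lee_wpmul2l _ (discounted_second_moment l0))) _.
  by rewrite lee_fin ltW.
have I0 : (0 <= \int[P]_w discounted (r ^+ 2) (sg w) (fun=> 1%R))%E by exact: integral_ge0.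
move: I0; set I := (\int[P]_w _)%E => I0.
rewrite muleA -EFinM -ge0_muleDl//; last first.
- by rewrite lee_fin mulr_ge0 ?ltW// divr_gt0.
apply: lee_wpmul2r => //; rewrite -EFinD lee_fin.
have -> : r * (6 / r ^+ 2) = 6 / r by field; rewrite gt_eqF.
have -> : (4 * r)^-1 = 4^-1 / r by rewrite invfM.
rewrite -mulrDl ler_pM2r ?invr_gt0//; lra.
Qed.

End StoppedMoments.

(** * Free boundaries of a monotone value function *)

Lemma lipschitz_bound_continuous (R : realType) (L : R) (f : R -> R) :
  (forall x y, `|f x - f y| <= L * `|x - y|) -> continuous f.
Proof.
move=> fL.
have L0 : 0 <= L.
  by have := le_trans (normr_ge0 _) (fL 1 0); rewrite subr0 normr1 mulr1.
have L1 : 0 < L + 1 by lra.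
move=> x; apply/cvgrPdist_le => e e0; near=> z.
apply: le_trans (fL x z) _.
apply: (@le_trans _ _ (L * (e / (L + 1)))).
  rewrite ler_wpM2l//; near: z; apply: (@cvgr_dist_le _ _ _ _ _ id); first exact: cvg_id.
  exact: divr_gt0.
rewrite mulrCA; apply: ler_piMr; first exact: ltW.
by rewrite ler_pdivrMr// mul1r lerDl.
Unshelve. all: by end_near. Qed.

Lemma lipschitz_bound_lipschitz (R : realType) (L : R) (f : R -> R) :
  (forall x y, `|f x - f y| <= L * `|x - y|) -> [lipschitz f y | y in [set: R]].
Proof.
move=> fL; exists L; split; first exact: num_real.
move=> M LM [x y] _ /=; apply: le_trans (fL x y) _.
by rewrite ler_wpM2r// ltW.
Qed.

Section FreeBoundaries.
Context (R : realType) (U : R -> R -> \bar R) (L Km Kp cm cp : R).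
Hypothesis L0 : 0 <= L.
Hypothesis U_mono : forall x x' y y' : R, x <= x' -> 0 <= (x' - x) + (y' - y) * L ->
  (U x y <= U x' y')%E.
Hypothesis Km_lb : forall x y, (Km%:E <= U x y)%E -> cm <= x.
Hypothesis Kp_ub : forall x y, (U x y <= (- Kp)%:E)%E -> x <= cp.
Hypothesis Km_reached : forall y, exists x, (Km%:E <= U x y)%E.
Hypothesis Kp_reached : forall y, exists x, (U x y <= (- Kp)%:E)%E.

Let am := a_minus U Km.
Let ap := a_plus U Kp.

Lemma a_minus_ge y : (cm%:E <= am y)%E.
Proof. by apply: le_ereal_inf_tmp => _ [x /= Ux <-]; rewrite lee_fin; exact: Km_lb Ux. Qed.

Lemma a_plus_le y : (ap y <= cp%:E)%E.
Proof. by apply: ge_ereal_sup => _ [x /= Ux <-]; rewrite lee_fin; exact: Kp_ub Ux. Qed.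

Lemma a_minus_lty y : (am y < +oo)%E.
Proof.
have [x Ux] := Km_reached y; apply: (@le_lt_trans _ _ x%:E); last exact: ltry.
by apply: ereal_inf_lbound; exists x.
Qed.

Lemma a_plus_gtNy y : (-oo < ap y)%E.
Proof.
have [x Ux] := Kp_reached y; apply: (@lt_le_trans _ _ x%:E); first exact: ltNyr.
by apply: ereal_sup_ubound; exists x.
Qed.

Lemma a_minus_fin y : am y \is a fin_num.
Proof.
rewrite fin_numE gt_eqF ?lt_eqF ?a_minus_lty//.
by apply: lt_le_trans (a_minus_ge y); exact: ltNyr.
Qed.

Lemma a_plus_fin y : ap y \is a fin_num.
Proof.
rewrite fin_numE gt_eqF ?a_plus_gtNy ?lt_eqF//.
by apply: le_lt_trans (a_plus_le y) _; exact: ltry.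
Qed.

Lemma a_minus_noninc y y' : y <= y' -> (am y' <= am y)%E.
Proof.
move=> yy'; apply: le_ereal_inf => _ [x /= Ux <-]; exists x => //=.
apply: le_trans Ux _; apply: U_mono => //.
by rewrite subrr add0r mulr_ge0// subr_ge0.
Qed.

Lemma a_plus_noninc y y' : y <= y' -> (ap y' <= ap y)%E.
Proof.
move=> yy'; apply: le_ereal_sup => _ [x /= Ux <-]; exists x => //=.
apply: le_trans Ux; apply: U_mono => //.
by rewrite subrr add0r mulr_ge0// subr_ge0.
Qed.

(** A gain h in y is worth at most a gain L h in x, so the superlevel set at y
    contains the one at y' translated by L (y' - y). *)
Lemma a_minus_slope y y' : y <= y' -> (am y <= am y' + (L * (y' - y))%:E)%E.
Proof.
move=> yy'; rewrite -leeBlDr//; apply: le_ereal_inf_tmp => _ [x Ux <-].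
rewrite leeBlDr// -EFinD; apply: ereal_inf_lbound; exists (x + L * (y' - y)) => //.
apply: (le_trans Ux); apply: U_mono.
  by rewrite lerDl mulr_ge0// subr_ge0.
by rewrite [leRHS](_ : _ = 0)//; ring.
Qed.

Lemma a_plus_slope y y' : y <= y' -> (ap y <= ap y' + (L * (y' - y))%:E)%E.
Proof.
move=> yy'; apply: ge_ereal_sup => _ [x Ux <-].
rewrite -leeBlDr// -EFinB; apply: ereal_sup_ubound; exists (x - L * (y' - y)) => //.
apply: le_trans Ux; apply: U_mono.
  by rewrite gerBl mulr_ge0// subr_ge0.
by rewrite [leRHS](_ : _ = 0)//; ring.
Qed.

Let noninc_slope_bound (f : R -> \bar R) : (forall y, f y \is a fin_num) ->
  (forall y y', y <= y' -> (f y' <= f y)%E) ->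
  (forall y y', y <= y' -> (f y <= f y' + (L * (y' - y))%:E)%E) ->
  forall y y', `|fine (f y) - fine (f y')| <= L * `|y - y'|.
Proof.
move=> ffin fn fs y y'; wlog yy' : y y' / y <= y'.
  move=> h; have [/h//|/ltW/h] := leP y y'.
  by rewrite distrC [X in _ <= L * X]distrC.
have := fn y y' yy'; have := fs y y' yy'.
rewrite -(fineK (ffin y)) -(fineK (ffin y')) -EFinD !lee_fin /= => h1 h2.
rewrite ger0_norm ?subr_ge0// distrC ger0_norm ?subr_ge0//.
by rewrite lerBlDl.
Qed.

Lemma a_minus_lipschitz_bound y y' : `|fine (am y) - fine (am y')| <= L * `|y - y'|.
Proof.
by apply: noninc_slope_bound; [exact: a_minus_fin|exact: a_minus_noninc|exact: a_minus_slope].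
Qed.

Lemma a_plus_lipschitz_bound y y' : `|fine (ap y) - fine (ap y')| <= L * `|y - y'|.
Proof.
by apply: noninc_slope_bound; [exact: a_plus_fin|exact: a_plus_noninc|exact: a_plus_slope].
Qed.

Lemma a_minus_continuous : continuous am.
Proof.
have -> : am = EFin \o (fine \o am) by apply/funext => y /=; rewrite fineK// a_minus_fin.
move=> y; apply: cvg_EFin; first by near=> z.
exact: (lipschitz_bound_continuous a_minus_lipschitz_bound).
Unshelve. all: by end_near. Qed.

Lemma a_plus_continuous : continuous ap.
Proof.
have -> : ap = EFin \o (fine \o ap) by apply/funext => y /=; rewrite fineK// a_plus_fin.
move=> y; apply: cvg_EFin; first by near=> z.
exact: (lipschitz_bound_continuous a_plus_lipschitz_bound).
Unshelve. all: by end_near. Qed.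

End FreeBoundaries.

(** * From the filtered space to continuous processes *)

(** The directions (1, 0), (-1, 0), (0, 1) and (0, -1) of the joint Gaussian law
    give the laws of both increments and of their opposites. *)
Lemma correlated_scalar_brownian (R : realType) (d : measure_display)
    (Omega : measurableType d) (P : probability Omega R) (F : R -> set (set Omega))
    (rho : R) (W1 W2 : R -> Omega -> R) :
  correlated_brownian_motions P F rho W1 W2 ->
  scalar_brownian P F W1 /\ scalar_brownian P F W2.
Proof.
case=> -[aW1 aW2] W0 _ ind law; split; split => //.
- by apply: filterS W0 => w [].
- move=> s t s0 st A C FA mC.
  have mC' : measurable (C `*` [set: R]) by exact: measurableX.
  have := ind s t s0 st A _ FA mC'.
  rewrite (_ : [set w | _] = [set w | C (W1 t w - W1 s w)])//.
  by apply/seteqP; split => w //= [].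
- move=> s t s0 st B mB; split.
    have n0 : ((1 : R), (0 : R)) != (0, 0) by rewrite xpair_eqE oner_eq0.
    have := law s t s0 st 1 0 n0 B mB.
    rewrite (_ : (t - s) * _ = t - s); last by rewrite expr1n expr0n/=; ring.
    by under eq_set do rewrite mul1r mul0r addr0.
  have n0 : ((-1 : R), (0 : R)) != (0, 0) by rewrite xpair_eqE oppr_eq0 oner_eq0.
  have := law s t s0 st (-1) 0 n0 B mB.
  rewrite (_ : (t - s) * _ = t - s); last by ring.
  by under eq_set do rewrite mulN1r mul0r addr0.
- by apply: filterS W0 => w [].
- move=> s t s0 st A C FA mC.
  have mC' : measurable ([set: R] `*` C) by exact: measurableX.
  have := ind s t s0 st A _ FA mC'.
  rewrite (_ : [set w | _] = [set w | C (W2 t w - W2 s w)])//.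
  by apply/seteqP; split => w //= [].
- move=> s t s0 st B mB; split.
    have n0 : ((0 : R), (1 : R)) != (0, 0) by rewrite xpair_eqE oner_eq0 andbF.
    have := law s t s0 st 0 1 n0 B mB.
    rewrite (_ : (t - s) * _ = t - s); last by ring.
    by under eq_set do rewrite mul1r mul0r add0r.
  have n0 : ((0 : R), (-1 : R)) != (0, 0) by rewrite xpair_eqE oppr_eq0 oner_eq0 andbF.
  have := law s t s0 st 0 (-1) n0 B mB.
  rewrite (_ : (t - s) * _ = t - s); last by ring.
  by under eq_set do rewrite mulN1r mul0r add0r.
Qed.

Section StoppingTimes.
Context (R : realType) (d : measure_display) (Omega : measurableType d)
  (P : probability Omega R) (F : R -> set (set Omega)) (W1 W2 : R -> Omega -> R).
Hypothesis hF : complete_filtration P F.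
Hypothesis aW1 : adapted F W1.
Hypothesis aW2 : adapted F W2.

Lemma brownian_filtration_sub t : 0 <= t -> brownian_filtration P W1 W2 t `<=` F t.
Proof.
move=> t0; case: hF => sF mF iF nF.
apply: smallest_sub; first exact: sF.
move=> A [[s [/andP[s0 st] [B [mB AE]]]]|NA]; last exact: nF.
by apply: (iF s t s0 st); case: AE => ->; [exact: aW1|exact: aW2].
Qed.

Variable sg : Omega -> \bar R.
Hypothesis hsg : stopping_time (brownian_filtration P W1 W2) sg.

Lemma stopping_time_filtration t : 0 <= t -> F t [set w | (sg w <= t%:E)%E].
Proof. by case: hsg => _ h t0; apply: (brownian_filtration_sub t0); exact: h. Qed.

Lemma measurable_stopping_time : measurable_fun setT sg.
Proof.
apply: (measurability _ (ErealGenOInfty.measurableE R)) => //.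
move=> _ [_ [x ->] <-]; rewrite setTI.
have -> : sg @^-1` `]x%:E, +oo[ = ~` [set w | (sg w <= x%:E)%E].
  by apply/seteqP; split => w /=; rewrite in_itv/= andbT ltNge => /negP.
apply: measurableC; have [x0|x0] := leP 0 x.
  exact: (filtration_measurable hF x0 (stopping_time_filtration x0)).
rewrite (_ : [set w | _] = set0)//; apply/seteqP; split => w //=.
case: hsg => sg0 _ => /(le_trans (sg0 w)); rewrite lee_fin => x0'.
by move: (lt_le_trans x0 x0'); rewrite ltxx.
Qed.

End StoppingTimes.

(** Setting the process to zero on a null set makes every path continuous without
    affecting the moments. *)
Lemma brownian_modification (R : realType) (d : measure_display)
    (Omega : measurableType d) (P : probability Omega R) (F : R -> set (set Omega))
    (W : R -> Omega -> R) : complete_filtration P F -> scalar_brownian P F W ->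
  {ae P, forall w, continuous_path W w} ->
  exists Z : R -> Omega -> R,
  [/\ forall t, measurable_fun setT (Z t),
      forall w, continuous (fun t => Z t w),
      (\int[P]_w ((Z 0%R w) ^+ 2)%:E = 0)%E,
      forall (s t : R) (A : set Omega), 0 <= s -> s < t -> F s A ->
        (\int[P]_w (\1_A w * (Z t w) ^+ 2)%:E <=
         \int[P]_w (\1_A w * (Z s w) ^+ 2)%:E + (6 * (t - s))%:E * P A)%E &
      {ae P, forall w, forall t : R, 0 <= t -> Z t w = W t w}].
Proof.
move=> hF hW cW.
have [aW W0 _ _] := hW.
have [N [mN N0 sN]] : {ae P, forall w, W 0 w = 0 /\ continuous_path W w}.
  by apply: filterS2 W0 cW => w; split.
pose Z (t : R) w := \1_(~` N) w * W (Num.max t 0) w.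
have m0 (t : R) : 0 <= Num.max t 0 by rewrite le_max lexx orbT.
have mZ t : measurable_fun setT (Z t).
  apply: measurable_funM; first by have mNC := measurableC mN; exact: measurable_indic.
  exact: (measurable_brownian hF hW).
have good w : ~ N w -> W 0 w = 0 /\ continuous_path W w.
  by move=> Nw; apply: contrapT => h; apply: Nw; exact: sN.
have ZW w t : ~ N w -> 0 <= t -> Z t w = W t w.
  by move=> Nw t0; rewrite /Z indicE mem_set// mul1r max_l.
have aeZW (t : R) : 0 <= t -> {ae P, forall w, Z t w = W t w}.
  move=> t0; exists N; split => // w /= h; apply: contrapT => Nw; apply: h; exact: ZW.
have intZ (A : set Omega) (t : R) : 0 <= t ->
    (\int[P]_w (\1_A w * (Z t w) ^+ 2)%:E = \int[P]_w (\1_A w * (W t w) ^+ 2)%:E)%E.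
  move=> t0; apply/eqP; rewrite eq_le; apply/andP.
  by split; apply: ae_le_integral_unmeasured; apply: filterS (aeZW t t0) => w ->.
exists Z; split => //.
- move=> w; have [wN|wN] := boolP (w \in ~` N).
    have [_ /continuous_halfline_ext cw] := good w (set_mem wN).
    by rewrite /Z indicE wN; under eq_fun do rewrite mul1r.
  rewrite /Z indicE (negbTE wN); under eq_fun do rewrite mul0r.
  exact: cst_continuous.
- apply: integral0_eq => w _; rewrite /Z indicE.
  have [wN|wN] := boolP (w \in ~` N); last by rewrite mul0r expr0n.
  by have [e _] := good w (set_mem wN); rewrite max_l// e mulr0 expr0n.
- move=> s t A s0 st FA; have t0 : 0 <= t by rewrite (le_trans s0)// ltW.
  by rewrite !intZ//; exact: (increment_second_moment hF hW).
- by exists N; split => // w /= h; apply: contrapT => Nw; apply: h => t t0; exact: ZW.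
Qed.

(** * The payoff along one path *)

Lemma dcostE (R : realType) (x : R) : dcost x = x.
Proof.
rewrite /dcost /cost derive1Mr; last exact: exprn_derivable.
by rewrite derive1E exp_derive expr1 /GRing.scale/= mulr1; field.
Qed.

Lemma dcost_invE (R : realType) (x : R) : dcost_inv x = x.
Proof.
have E : @dcost R = id by apply/funext => u; exact: dcostE.
have inj : {in [set: R] &, injective (@id R)} by [].
have := @pinvKV _ _ (fun=> 0) [set: R] (@id R) inj x (mem_set I).
by rewrite /dcost_inv E.
Qed.

(** exp (- delta sg), extended by its limit at infinity. *)
Definition discount_factor (R : realType) (delta : R) (sg : \bar R) : R :=
  if sg is r%:E then expR (- delta * r) else 0.

Lemma discount_factor_itv (R : realType) (delta : R) (sg : \bar R) :
  0 < delta -> (0 <= sg)%E -> 0 <= discount_factor delta sg <= 1.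
Proof.
move=> d0; case: sg => [r||]//=; rewrite ?lexx ?ler01// lee_fin => r0.
by rewrite expR_ge0 expR_le1 mulNr oppr_le0 mulr_ge0// ltW.
Qed.

Lemma discount_factor_le (R : realType) (delta : R) (s t : \bar R) :
  0 < delta -> (0 <= s)%E -> (s <= t)%E ->
  discount_factor delta t <= discount_factor delta s.
Proof.
move=> d0; case: s => [s||]//; case: t => [t||]//=; rewrite ?expR_ge0// !lee_fin => _ st.
by rewrite ler_expR ler_nM2l ?oppr_lt0.
Qed.

Lemma discounted_const1 (R : realType) (delta : R) (sg : \bar R) :
  0 < delta -> (0 <= sg)%E ->
  discounted delta sg (fun=> 1) = (delta^-1 * (1 - discount_factor delta sg))%:E.
Proof.
move=> d0; case: sg => [r||]//=; first by rewrite lee_fin => r0; rewrite discounted_const1_fin.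
by rewrite discounted_const1_pinfty// subr0 mulr1.
Qed.

Lemma discounted_expR (R : realType) (delta : R) (sg : \bar R) :
  0 < delta -> (0 <= sg)%E ->
  discounted delta sg (fun t => expR (- delta * t)) =
  ((2 * delta)^-1 * (1 - discount_factor delta sg ^+ 2))%:E.
Proof.
move=> d0 sg0.
have -> : discounted delta sg (fun t => expR (- delta * t)) = discounted (2 * delta) sg (fun=> 1).
  apply: eq_integral => t _; congr EFin; rewrite mulr1 -expRD; congr expR; ring.
rewrite discounted_const1 ?mulr_gt0//; congr (_ * (1 - _))%:E.
case: sg sg0 => [r||] //=; rewrite ?expr0n// => _.
by rewrite expr2 -expRD; congr expR; ring.
Qed.

Lemma discounted_integrable (R : realType) (lam : R) (sg : \bar R) (h : R -> R) :
  measurable_fun setT h -> (discounted lam sg (fun t => `|h t|%R) < +oo)%E ->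
  lebesgue_measure.-integrable (horizon sg) (EFin \o (fun t : R => expR (- lam * t) * h t)).
Proof.
move=> mh hoo; apply/integrableP; split.
  apply/measurable_EFinP; apply: measurable_funM; first exact: measurable_expRM.
  exact: measurable_funTS.
apply: le_lt_trans hoo; apply: ae_le_integral_unmeasured; apply: aeW => t _.
by rewrite /= normrM (ger0_norm (expR_ge0 _)).
Qed.

Lemma discounted_lty_dominated (R : realType) (lam : R) (sg : \bar R) (c : R) (h k : R -> R) :
  0 < lam -> (0 <= sg)%E -> measurable_fun setT k -> (forall t, 0 <= k t) ->
  (forall t, 0 <= t -> `|h t| <= c + k t) ->
  (discounted lam sg k < +oo)%E -> (discounted lam sg (fun t => `|h t|%R) < +oo)%E.
Proof.
move=> l0 sg0 mk k0 hk koo.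
have hk' (t : R) : 0 <= t -> `|h t| <= `|c| * 1 + k t.
  by move=> t0; rewrite mulr1; apply: le_trans (hk t t0) _; rewrite lerD2r ler_norm.
apply: le_lt_trans (le_discounted _ _ hk') _.
have mc : measurable_fun setT (fun _ : R => 1 : R) by exact: measurable_cst.
have mc' : measurable_fun setT (fun _ : R => `|c| * 1 : R) by exact: measurable_cst.
rewrite discountedD//.
by rewrite discountedZ// lte_add_pinfty// discounted_const1// -EFinM ltry.
Qed.

Section PathPayoff.
Context (R : realType) (delta : R).
Hypothesis d0 : 0 < delta.

(** The payoff of the game as a function of one path and of the two stopping
    dates; [discount_factor] dispenses with the finite part of a date. *)
Definition path_payoff (Kp Km : R) (p : R -> R) (tau theta : \bar R) : R :=
  fine (discounted delta (Order.min tau theta) p)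
  + Km * discount_factor delta tau * (tau < theta)%E%:R
  - Kp * discount_factor delta theta * (theta < tau)%E%:R.

Variables (x : R) (p : R -> R).
Hypothesis cp : continuous p.
Let dev (t : R) : R := `|p t - x * expR (- delta * t)|.

Let mp : measurable_fun setT p.
Proof. exact: continuous_measurable_fun. Qed.

Let mxe : measurable_fun setT (fun t : R => x * expR (- delta * t)).
Proof. by apply: measurable_funM => //; exact: measurable_expRM. Qed.

Lemma measurable_path_deviation : measurable_fun setT dev.
Proof.
rewrite /dev; apply: (@measurableT_comp _ _ _ _ _ _ (@Num.norm R R)) => //.
exact: measurable_funB.
Qed.

Lemma path_integrable sg : (0 <= sg)%E -> (discounted delta sg dev < +oo)%E ->
  lebesgue_measure.-integrable (horizon sg) (EFin \o (fun t : R => expR (- delta * t) * p t)).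
Proof.
move=> sg0 Doo; apply: discounted_integrable => //.
apply: (@discounted_lty_dominated _ _ _ `|x| _ dev) => //.
- exact: measurable_path_deviation.
- by move=> t; exact: normr_ge0.
- move=> t t0; rewrite -{1}(subrK (x * expR (- delta * t)) (p t)) addrC.
  apply: le_trans (ler_normD _ _) _; rewrite lerD2r normrM (ger0_norm (expR_ge0 _)).
  by rewrite ler_piMr// expR_le1 mulNr oppr_le0 mulr_ge0// ltW.
Qed.

Lemma path_running_le sg (k : R -> R) : (0 <= sg)%E -> (discounted delta sg dev < +oo)%E ->
  measurable_fun setT k -> (discounted delta sg (fun t => `|k t|%R) < +oo)%E ->
  (forall t, 0 <= t -> p t <= k t + dev t) ->
  fine (discounted delta sg p) <= fine (discounted delta sg k) + fine (discounted delta sg dev).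
Proof.
move=> sg0 Doo mk koo pk.
have iD : lebesgue_measure.-integrable (horizon sg) (EFin \o (fun t : R => expR (- delta * t) * dev t)).
  apply: discounted_integrable; first exact: measurable_path_deviation.
  by apply: le_lt_trans Doo; apply: le_discounted => t _; rewrite /dev normr_id.
have ik := discounted_integrable mk koo.
have ip := path_integrable sg0 Doo.
have -> : fine (discounted delta sg k) + fine (discounted delta sg dev) =
    \int[lebesgue_measure]_(t in horizon sg)
      (expR (- delta * t) * k t + expR (- delta * t) * dev t).
  by rewrite RintegralD; [|exact: measurable_horizon|exact: ik|exact: iD].
apply: le_Rintegral => //; first exact: measurable_horizon.
- by apply: (integrableD _ ik iD); exact: measurable_horizon.
- by move=> t [t0 _]; rewrite -mulrDr ler_wpM2l// ?expR_ge0// pk.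
Qed.

Lemma path_running_ge sg (k : R -> R) : (0 <= sg)%E -> (discounted delta sg dev < +oo)%E ->
  measurable_fun setT k -> (discounted delta sg (fun t => `|k t|%R) < +oo)%E ->
  (forall t, 0 <= t -> k t - dev t <= p t) ->
  fine (discounted delta sg k) - fine (discounted delta sg dev) <= fine (discounted delta sg p).
Proof.
move=> sg0 Doo mk koo pk.
have iD : lebesgue_measure.-integrable (horizon sg) (EFin \o (fun t : R => expR (- delta * t) * dev t)).
  apply: discounted_integrable; first exact: measurable_path_deviation.
  by apply: le_lt_trans Doo; apply: le_discounted => t _; rewrite /dev normr_id.
have ik := discounted_integrable mk koo.
have ip := path_integrable sg0 Doo.
have -> : fine (discounted delta sg k) - fine (discounted delta sg dev) =
    \int[lebesgue_measure]_(t in horizon sg)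
      (expR (- delta * t) * k t - expR (- delta * t) * dev t).
  by rewrite RintegralB; [|exact: measurable_horizon|exact: ik|exact: iD].
apply: le_Rintegral => //; first exact: measurable_horizon.
- by apply: (integrableB _ ik iD); exact: measurable_horizon.
- by move=> t [t0 _]; rewrite -mulrBr ler_wpM2l// ?expR_ge0// pk.
Qed.

(** Since Km exp (- delta tau) = Km - delta Km int_0^tau exp (- delta t) dt, the
    payoff is Km plus an integral over [0, tau].  With f = exp (- delta tau), the
    contribution of x exp (- delta t) is x (1 - f^2) / (2 delta), at least half of
    x (1 - f) / delta. *)
Lemma path_payoff_never_stop_ge Kp Km tau : 0 <= x -> (0 <= tau)%E ->
  (discounted delta tau dev < +oo)%E ->
  Km + (x / 2 - delta * Km) * fine (discounted delta tau (fun=> 1))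
    - fine (discounted delta tau dev) <= path_payoff Kp Km p tau +oo%E.
Proof.
move=> x0 tau0 Doo; rewrite /path_payoff.
have -> : Order.min tau +oo%E = tau by apply/min_idPl; exact: leey.
have -> : (+oo < tau)%E = false by apply/negbTE; rewrite -leNgt leey.
have -> : Km * discount_factor delta tau * (tau < +oo)%E%:R = Km * discount_factor delta tau.
  by case: tau {tau0 Doo} => [r||]//=; rewrite ?ltry ?mulr1 ?mulr0 ?mul0r.
rewrite mulr0 subr0.
have me : measurable_fun setT (fun t : R => expR (- delta * t)) by exact: measurable_expRM.
have koo : (discounted delta tau (fun t => `|x * expR (- delta * t)|%R) < +oo)%E.
  have -> : (fun t => `|x * expR (- delta * t)|) = (fun t => x * expR (- delta * t)).
    by apply/funext => t; rewrite ger0_norm// mulr_ge0// expR_ge0.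
  rewrite discountedZ//.
  by rewrite discounted_expR// -EFinM ltry.
have := path_running_ge tau0 Doo mxe koo _.
rewrite discountedZ//.
rewrite discounted_expR// discounted_const1// -EFinM /=.
set dv := fine _; set I := fine _; set f := discount_factor _ _.
move=> /(_ _)/wrap[].
  by move=> t t0; rewrite /dev lerBlDr -lerBlDl distrC ler_norm.
have /andP[f0 f1] := discount_factor_itv d0 tau0; rewrite -/f in f0 f1.
move=> h.
have e1 : (x / 2 - delta * Km) * (delta^-1 * (1 - f)) =
    x / (2 * delta) * (1 - f) - Km * (1 - f).
  by field; rewrite gt_eqF.
have e2 : x * ((2 * delta)^-1 * (1 - f ^+ 2)) = x / (2 * delta) * (1 - f ^+ 2) by ring.
rewrite e2 in h; rewrite e1.
have : x / (2 * delta) * (1 - f) <= x / (2 * delta) * (1 - f ^+ 2).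
  apply: ler_wpM2l; first by rewrite divr_ge0// mulr_ge0// ltW.
  by rewrite lerD2l lerN2 expr2 ler_piMr.
lra.
Qed.

(** Whoever stops first, the running cost is at most x0 per unit of discounted
    time, up to the deviation; if the opponent stops first, the payment to the
    minimiser only lowers the payoff. *)
Lemma path_payoff_short_stop_le Kp Km (t0 x0 : R) (theta : \bar R) :
  0 <= Kp -> x <= x0 -> 0 <= x0 -> x0 <= Km * delta -> 0 <= t0 -> (0 <= theta)%E ->
  (discounted delta t0%:E dev < +oo)%E ->
  path_payoff Kp Km p t0%:E theta <=
  Km - (Km - x0 / delta) * (1 - expR (- delta * t0)) + fine (discounted delta t0%:E dev).
Proof.
move=> Kp0 xx0 x00 x0K t00 th0 Doo; rewrite /path_payoff.
set m := Order.min _ _.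
have m0 : (0 <= m)%E by rewrite /m le_min lee_fin t00.
have mt0 : (m <= t0%:E)%E by rewrite /m ge_min lexx.
have Dm : (discounted delta m dev <= discounted delta t0%:E dev)%E.
  apply: ge0_subset_integral; [exact: measurable_horizon|exact: measurable_horizon|..].
  - apply/measurable_EFinP; apply: measurable_funM; first exact: measurable_expRM.
    by apply: measurable_funTS; exact: measurable_path_deviation.
  - by move=> t _; rewrite lee_fin mulr_ge0 ?expR_ge0//; exact: normr_ge0.
  - by move=> t [tt0 tm]; split => //; exact: le_trans mt0.
have Dmoo := le_lt_trans Dm Doo.
have fD : fine (discounted delta m dev) <= fine (discounted delta t0%:E dev).
  have D0 s : (0 <= discounted delta s dev)%E.
    by apply: discounted_ge0 => t _; exact: normr_ge0.
  by apply: fine_le => //; rewrite ge0_fin_numE.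
have mc (c : R) : measurable_fun setT (fun _ : R => c) by exact: measurable_cst.
have x0E s : discounted delta s (fun=> x0) = (x0%:E * discounted delta s (fun=> 1%R))%E.
  by rewrite -discountedZ//; congr discounted; apply/funext => t; rewrite mulr1.
have koo : (discounted delta m (fun t => `|x0|%R) < +oo)%E.
  by rewrite ger0_norm// x0E discounted_const1// -EFinM ltry.
have := path_running_le m0 Dmoo (mc x0) koo _.
rewrite x0E discounted_const1// -EFinM /=.
set dv := fine (discounted delta m dev) in fD *; set I := fine _.
set dv0 := fine (discounted _ t0%:E _) in fD *.
move=> /(_ _)/wrap[].
  move=> t tt0; rewrite -lerBlDl.
  apply: (@le_trans _ _ (p t - x * expR (- delta * t))); last exact: ler_norm.
  rewrite lerD2l lerN2; apply: (@le_trans _ _ (x0 * expR (- delta * t))).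
    by rewrite ler_wpM2r ?expR_ge0.
  by rewrite ler_piMr// expR_le1 mulNr oppr_le0 mulr_ge0// ltW.
set e := expR (- delta * t0) => h.
have dme : e <= discount_factor delta m by exact: (discount_factor_le d0 m0 mt0).
have /andP[dm0 dm1] := discount_factor_itv d0 m0.
have c0 : 0 <= x0 / delta by rewrite divr_ge0// ltW.
have cK : x0 / delta <= Km by rewrite ler_pdivrMr.
have hE : x0 * (delta^-1 * (1 - discount_factor delta m)) =
  x0 / delta * (1 - discount_factor delta m) by ring.
rewrite hE in h.
have Kd : 0 <= Kp * discount_factor delta theta * (theta < t0%:E)%E%:R.
  rewrite mulr_ge0// mulr_ge0//; first by have /andP[] := discount_factor_itv d0 th0.
have [tth|tht] := ltP t0%:E theta.
  have mE : m = t0%:E by rewrite /m; apply/min_idPl; exact: ltW.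
  have fE : discount_factor delta m = e by rewrite mE.
  rewrite fE in h; rewrite mulr1 /= -/e; move: Kd h fD; lra.
have e0 : 0 <= e by exact: expR_ge0.
have e1 : e <= 1 by exact: le_trans dm1.
have hh : x0 / delta * (1 - discount_factor delta m) <= x0 / delta * (1 - e).
  by rewrite ler_wpM2l// lerD2l lerN2.
rewrite mulr0 addr0.
have hK : 0 <= Km * e by rewrite mulr_ge0// (le_trans c0).
move: Kd h fD hh hK. lra.
Qed.

End PathPayoff.

(** * Deviation of the state from its deterministic decay *)

(** Exchanging the players and their costs while changing the sign of the path
    changes the sign of the payoff. *)
Lemma path_payoff_opp (R : realType) (delta Kp Km : R) (p : R -> R) (tau theta : \bar R) :
  lebesgue_measure.-integrable (horizon (Order.min tau theta))
    (EFin \o (fun t : R => expR (- delta * t) * p t)) ->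
  path_payoff delta Kp Km p tau theta = - path_payoff delta Km Kp (fun t => - p t) theta tau.
Proof.
move=> ip; rewrite /path_payoff minC.
have -> : fine (discounted delta (Order.min theta tau) (fun t => - p t)) =
    - fine (discounted delta (Order.min theta tau) p).
  rewrite (minC theta).
  transitivity (\int[lebesgue_measure]_(t in horizon (Order.min tau theta))
      (-1 * (expR (- delta * t) * p t))).
    by apply: eq_Rintegral => t _; rewrite mulN1r mulrN.
  by rewrite RintegralZl; [rewrite mulN1r|exact: measurable_horizon|exact: ip].
ring.
Qed.

Section StoppedProcess.
Context (R : realType) (d : measure_display) (Omega : measurableType d)
  (P : probability Omega R) (F : R -> set (set Omega)) (W1 W2 : R -> Omega -> R).
Variables (m b delta sigma1 sigma2 rho : R).
Variables (X : R -> R -> R -> Omega -> R) (Y : R -> R -> Omega -> R).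
Hypothesis hb : 0 < b.
Hypothesis hdelta : 0 < delta.
Hypothesis hsigma1 : 0 < sigma1.
Hypothesis hsigma2 : 0 < sigma2.
Hypothesis hbdelta : delta < b.
Hypothesis hF : complete_filtration P F.
Hypothesis hW : correlated_brownian_motions P F rho W1 W2.
Hypothesis hXY : forall x y : R,
  solves_sde P F W1 W2 m b delta sigma1 sigma2 x y (X x y) (Y y).

(** The path frozen before time 0, continuous on the whole line. *)
Definition half_path (V : R -> Omega -> R) (w : Omega) (t : R) : R := V (Num.max t 0) w.

Lemma ae_sde_path x y (Z1 Z2 : R -> Omega -> R) :
  {ae P, forall w, forall t : R, 0 <= t -> Z1 t w = W1 t w} ->
  {ae P, forall w, forall t : R, 0 <= t -> Z2 t w = W2 t w} ->
  {ae P, forall w, sde_path m b delta sigma1 sigma2 x y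
    (half_path (X x y) w) (half_path (Y y) w) (fun t => Z1 t w) (fun t => Z2 t w)}.
Proof.
move=> ZW1 ZW2; have [_ cXY EX EY] := hXY x y.
apply: filterS2 (filterI ZW1 ZW2) (filterI cXY (filterI EX EY)).
move=> w [e1 e2] [[/continuous_halfline_ext cX /continuous_halfline_ext cY] [eX eY]].
have mx (t : R) : 0 <= t -> Num.max t 0 = t by move=> t0; rewrite max_l.
split => // t t0; rewrite /half_path mx//.
- rewrite eX// e1//; congr (_ + _ + _); apply: eq_Rintegral => s; rewrite inE/= in_itv/=.
  by case/andP => s0 _; rewrite mx.
- rewrite eY// e2//; congr (_ + _ + _); apply: eq_Rintegral => s; rewrite inE/= in_itv/=.
  by case/andP => s0 _; rewrite mx.
Qed.

(** The constant of [discounted_deviation_bound], obtained by inserting the moment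
    bound 7 / r of each Brownian motion in [sde_path_discounted_bound] at rate
    lam = r^2.  It is O (1 / r) for large r. *)
Definition deviation_rate (y r : R) : R :=
  (`|y| + `|m| / r ^+ 2) / r ^+ 2 +
  (sigma1 * (1 + delta / r ^+ 2) + sigma2 * (1 + b / r ^+ 2) / r ^+ 2) * (7 / r).

Definition deviation x y w (t : R) : R :=
  `|half_path (X x y) w t - x * expR (- delta * t)|.

(** The deviation itself need not be jointly measurable, so its expectation is
    controlled through a measurable majorant B. *)
Lemma discounted_deviation_bound x y r (sg : Omega -> \bar R) : 0 < r ->
  stopping_time (brownian_filtration P W1 W2) sg ->
  exists B : Omega -> \bar R,
  [/\ measurable_fun setT B, forall w, (0 <= B w)%E,
      {ae P, forall w, (discounted (r ^+ 2) (sg w) (deviation x y w) <= B w)%E} &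
      (\int[P]_w B w <= (deviation_rate y r)%:E *
         \int[P]_w discounted (r ^+ 2) (sg w) (fun=> 1%R))%E].
Proof.
move=> r0 hsg.
have [[aW1 aW2] _ cW _ _] := hW.
have [bW1 bW2] := correlated_scalar_brownian hW.
have cW1 : {ae P, forall w, continuous_path W1 w} by apply: filterS cW => w [].
have cW2 : {ae P, forall w, continuous_path W2 w} by apply: filterS cW => w [].
have [Z1 [mZ1 cZ1 Z10 iZ1 ZW1]] := brownian_modification hF bW1 cW1.
have [Z2 [mZ2 cZ2 Z20 iZ2 ZW2]] := brownian_modification hF bW2 cW2.
have msg := measurable_stopping_time hF aW1 aW2 hsg.
have Fsg := stopping_time_filtration hF aW1 aW2 hsg.
have l0 : 0 < r ^+ 2 by rewrite exprn_gt0.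
pose lam := r ^+ 2.
have mN (Z : R -> Omega -> R) : (forall t, measurable_fun setT (Z t)) ->
    (forall w, continuous (fun t => Z t w)) ->
    measurable_fun setT (fun w => discounted lam (sg w) (fun t => `|Z t w|)).
  move=> mZ cZ; apply: (@measurable_discounted _ _ _ lam sg (fun t w => `|Z t w|)) => //.
  apply: measurableT_comp => //; exact: measurable_continuous_process.
have m1 : measurable_fun setT (fun w => discounted lam (sg w) (fun=> 1)).
  exact: (@measurable_discounted _ _ _ lam sg (fun=> fun=> 1)).
have mN1 := mN _ mZ1 cZ1; have mN2 := mN _ mZ2 cZ2.
have p1 w : (0 <= discounted lam (sg w) (fun=> 1%R))%E by exact: discounted_ge0.
have pN (Z : R -> Omega -> R) w : (0 <= discounted lam (sg w) (fun t => `|Z t w|%R))%E.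
  exact: discounted_ge0.
pose c0 := (`|y| + `|m| / lam) / lam.
pose c1 := sigma1 * (1 + delta / lam).
pose c2 := sigma2 * (1 + b / lam) / lam.
have l0' : 0 <= lam := ltW l0.
have c00 : 0 <= c0 by rewrite divr_ge0// addr_ge0// divr_ge0.
have c10 : 0 <= c1 by rewrite mulr_ge0 ?(ltW hsigma1)// addr_ge0// divr_ge0// ltW.
have c20 : 0 <= c2.
  by rewrite divr_ge0// mulr_ge0 ?(ltW hsigma2)// addr_ge0// divr_ge0// ltW.
exists (fun w => c0%:E * discounted lam (sg w) (fun=> 1%R) +
   (c1%:E * discounted lam (sg w) (fun t => `|Z1 t w|%R) +
    c2%:E * discounted lam (sg w) (fun t => `|Z2 t w|%R)))%E; split.
- apply: emeasurable_funD; first exact: measurable_funeM.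
  by apply: emeasurable_funD; exact: measurable_funeM.
- by move=> w; rewrite !adde_ge0// mule_ge0.
- apply: filterS (ae_sde_path x y ZW1 ZW2) => w hp.
  exact: (sde_path_discounted_bound (sg w) l0 hb hdelta hsigma1 hsigma2 (cZ1 w) (cZ2 w) hp).
- rewrite ge0_integralD//; last 4 first.
  + by move=> w _; rewrite mule_ge0.
  + exact: measurable_funeM.
  + by move=> w _; rewrite adde_ge0// mule_ge0.
  + by apply: emeasurable_funD; exact: measurable_funeM.
  rewrite ge0_integralD//; last 4 first.
  + by move=> w _; rewrite mule_ge0.
  + exact: measurable_funeM.
  + by move=> w _; rewrite mule_ge0.
  + exact: measurable_funeM.
  rewrite !ge0_integralZl_EFin//.
  have i1 := discounted_first_moment hF mZ1 cZ1 Z10 iZ1 msg Fsg r0.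
  have i2 := discounted_first_moment hF mZ2 cZ2 Z20 iZ2 msg Fsg r0.
  apply: (@le_trans _ _ (c0%:E * \int[P]_w discounted lam (sg w) (fun=> 1%R) +
    (c1%:E * ((7 / r)%:E * \int[P]_w discounted lam (sg w) (fun=> 1%R)) +
     c2%:E * ((7 / r)%:E * \int[P]_w discounted lam (sg w) (fun=> 1%R))))%E).
    by rewrite leeD2l// leeD// lee_wpmul2l.
  have : (0 <= \int[P]_w discounted lam (sg w) (fun=> 1%R))%E by exact: integral_ge0.
  rewrite -/lam; set I := (\int[P]_w _)%E => I0.
  have r7 : 0 <= 7 / r by rewrite divr_ge0// ltW.
  have k1 : (0 <= (c1 * (7 / r))%:E)%E by rewrite lee_fin mulr_ge0.
  have k2 : (0 <= (c2 * (7 / r))%:E)%E by rewrite lee_fin mulr_ge0.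
  rewrite !muleA -!EFinM -ge0_muleDl// -ge0_muleDl//; last exact: adde_ge0.
  by rewrite -!EFinD -mulrDl.
Qed.

Lemma integral_discounted_const1_le r (sg : Omega -> \bar R) : 0 < r ->
  (forall w, 0 <= sg w)%E ->
  (\int[P]_w discounted r (sg w) (fun=> 1%R) <= (r^-1)%:E)%E.
Proof.
move=> r0 sg0; apply: (@le_trans _ _ (\int[P]_w (cst (r^-1)%:E) w)%E).
  apply: ae_le_integral_unmeasured; apply: aeW => w _.
  rewrite discounted_const1//= lee_fin; apply: ler_piMr; first by rewrite invr_ge0 ltW.
  by have /andP[f0 _] := discount_factor_itv r0 (sg0 w); rewrite gerBl.
by rewrite integral_cst//= probability_setT mule1.
Qed.

End StoppedProcess.

(** * The value of the game *)

Lemma discounted_horizon_le (R : realType) (lam : R) (s t : \bar R) (h : R -> R) :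
  measurable_fun setT h -> (forall u, 0 <= h u) -> (s <= t)%E ->
  (discounted lam s h <= discounted lam t h)%E.
Proof.
move=> mh h0 st.
apply: ge0_subset_integral; [exact: measurable_horizon|exact: measurable_horizon|..].
- apply/measurable_EFinP; apply: measurable_funM; first exact: measurable_expRM.
  exact: measurable_funTS.
- by move=> u _; rewrite lee_fin mulr_ge0 ?expR_ge0.
- by move=> u [u0 us]; split => //; exact: le_trans st.
Qed.

(** Before time 1 / lam, the discount at rate lam is at least exp (- 1); so
    short-time estimates are discounted estimates at a large rate. *)
Lemma discounted_short_horizon (R : realType) (delta lam : R) (h : R -> R) :
  0 <= delta -> 0 < lam -> measurable_fun setT h -> (forall u, 0 <= h u) ->
  (discounted delta (lam^-1)%:E h <= (expR 1)%:E * discounted lam +oo%E h)%E.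
Proof.
move=> d0 l0 mh h0.
apply: (@le_trans _ _ ((expR 1)%:E * discounted lam (lam^-1)%:E h)%E); last first.
  apply: lee_wpmul2l; first by rewrite lee_fin expR_ge0.
  by apply: discounted_horizon_le => //; exact: leey.
rewrite /discounted -ge0_integralZl_EFin; last 4 first.
- exact: measurable_horizon.
- by move=> u _; rewrite lee_fin mulr_ge0 ?expR_ge0.
- apply/measurable_EFinP; apply: measurable_funM; first exact: measurable_expRM.
  exact: measurable_funTS.
- exact: expR_ge0.
apply: ae_le_integral_unmeasured; apply: aeW => u [u0]; rewrite lee_fin => ul.
rewrite -EFinM lee_fin mulrA ler_wpM2r// -expRD ler_expR.
apply: (@le_trans _ _ 0); first by rewrite mulNr oppr_le0 mulr_ge0.
by rewrite mulNr subr_ge0 -ler_pdivlMl// mulr1.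
Qed.

Section GameValue.
Context (R : realType) (d : measure_display) (Omega : measurableType d)
  (P : probability Omega R) (F : R -> set (set Omega)) (W1 W2 : R -> Omega -> R).
Variables (m b delta sigma1 sigma2 Kp Km rho : R).
Variables (X : R -> R -> R -> Omega -> R) (Y : R -> R -> Omega -> R).
Hypothesis hb : 0 < b.
Hypothesis hdelta : 0 < delta.
Hypothesis hsigma1 : 0 < sigma1.
Hypothesis hsigma2 : 0 < sigma2.
Hypothesis hKp : 0 < Kp.
Hypothesis hKm : 0 < Km.
Hypothesis hbdelta : delta < b.
Hypothesis hF : complete_filtration P F.
Hypothesis hW : correlated_brownian_motions P F rho W1 W2.
Hypothesis hXY : forall x y : R,
  solves_sde P F W1 W2 m b delta sigma1 sigma2 x y (X x y) (Y y).

Let G := brownian_filtration P W1 W2.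
Let U := game_value P G delta Kp Km X.
Let payoff x y := game_payoff delta Kp Km (X x y).
Let rate := deviation_rate m b delta sigma1 sigma2.
Let dev := deviation delta X.

Lemma stopping_time_cst (c : \bar R) : (0 <= c)%E -> stopping_time G (fun=> c).
Proof.
move=> c0; split=> // t t0.
have [F0 C _] : sigma_algebra [set: Omega] (G t) by exact: smallest_sigma_algebra.
have [ct|ct] := leP c t%:E.
  rewrite (_ : [set _ | _] = [set: Omega] `\` set0); first exact: C.
  by rewrite setD0; apply/seteqP; split.
rewrite (_ : [set _ | _] = set0)//; apply/seteqP; split => w //=.
Qed.

Lemma game_payoffE x y (tau theta : Omega -> \bar R) w :
  (0 <= tau w)%E -> (0 <= theta w)%E ->
  payoff x y tau theta w =
  path_payoff delta Kp Km (half_path (X x y) w) (tau w) (theta w).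
Proof.
move=> tau0 theta0; rewrite /payoff /game_payoff /path_payoff; congr (_ + _ - _).
- apply: eq_Rintegral => t; rewrite inE => -[t0 _].
  by rewrite dcostE /half_path max_l.
- case: (tau w) tau0 => [r||]//= _.
  by rewrite ltNge leey/= !mulr0.
- case: (theta w) theta0 => [r||]//= _.
  by rewrite ltNge leey/= !mulr0.
Qed.

Lemma measurable_deviation x y w : continuous (half_path (X x y) w) -> measurable_fun setT (dev x y w).
Proof. by move=> cX; exact: (@measurable_path_deviation R delta x _ cX). Qed.

Lemma deviation_ge0 x y w t : 0 <= dev x y w t. Proof. exact: normr_ge0. Qed.

Lemma deviation_bound_lty x y r (sg : Omega -> \bar R) : 0 < r -> stopping_time G sg ->
  exists B : Omega -> \bar R,
  [/\ measurable_fun setT B, forall w, (0 <= B w)%E,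
      {ae P, forall w, (discounted (r ^+ 2) (sg w) (dev x y w) <= B w)%E},
      (\int[P]_w B w <= (rate y r)%:E *
         \int[P]_w discounted (r ^+ 2) (sg w) (fun=> 1%R))%E &
      (\int[P]_w B w < +oo)%E /\ {ae P, forall w, (B w < +oo)%E}].
Proof.
move=> r0 hsg.
have [B [mB B0 dB iB]] :=
  discounted_deviation_bound hb hdelta hsigma1 hsigma2 hF hW hXY x y r0 hsg.
have l0 : 0 < r ^+ 2 by rewrite exprn_gt0.
have i1 := @integral_discounted_const1_le _ _ _ P _ sg l0 hsg.1.
have Boo : (\int[P]_w B w < +oo)%E.
  have [N1fin|] := boolP ((\int[P]_w discounted (r ^+ 2) (sg w) (fun=> 1%R))%E \is a fin_num).
    by apply: le_lt_trans iB _; rewrite -(fineK N1fin) -EFinM ltry.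
  rewrite ge0_fin_numE; last by apply: integral_ge0 => w _; exact: discounted_ge0.
  by rewrite (le_lt_trans i1 (ltry _)).
exists B; split => //; split => //.
have iBT : P.-integrable setT B.
  apply/integrableP; split => //.
  by under eq_integral do rewrite gee0_abs//.
apply: filterS (integrable_ae measurableT iBT) => w /(_ I).
by rewrite ge0_fin_numE.
Qed.

(** Integrability up to infinity holds almost surely because the infinite horizon
    is a stopping time of finite discounted duration. *)
Lemma ae_good_path x y : {ae P, forall w, continuous (half_path (X x y) w) /\
  (discounted delta +oo%E (dev x y w) < +oo)%E}.
Proof.
have r0 : 0 < Num.sqrt delta by rewrite sqrtr_gt0.
have [B [_ _ dB _ [_ Boo]]] := deviation_bound_lty x y r0 (stopping_time_cst (leey _)).
have [_ cXY _ _] := hXY x y.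
apply: filterS3 cXY dB Boo => w [/continuous_halfline_ext cX _] h1 h2.
split=> //; apply: le_lt_trans h2; move: h1; rewrite sqr_sqrtr//; exact: ltW.
Qed.

Lemma good_path_lty x y w sg : continuous (half_path (X x y) w) ->
  (discounted delta +oo%E (dev x y w) < +oo)%E -> (discounted delta sg (dev x y w) < +oo)%E.
Proof.
move=> cX; apply: le_lt_trans; apply: discounted_horizon_le; [exact: measurable_deviation| |exact: leey].
exact: deviation_ge0.
Qed.

(** For fixed strategies the payoff is monotone in the path, and both extrema
    preserve the order. *)
Lemma game_value_mono x x' y y' : x <= x' -> 0 <= x' - x + (y' - y) / (b - delta) ->
  (U x y <= U x' y')%E.
Proof.
move=> xx' a0.
have [[aW1 aW2] _ cW _ _] := hW.
have cW1 : {ae P, forall w, continuous_path W1 w} by apply: filterS cW => w [].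
have cW2 : {ae P, forall w, continuous_path W2 w} by apply: filterS cW => w [].
have Wmax (V : R -> Omega -> R) w (t : R) : 0 <= t -> half_path V w t = V t w.
  by move=> t0; rewrite /half_path max_l.
have h := ae_sde_path hXY x y (aeW P (Wmax W1)) (aeW P (Wmax W2)).
have h' := ae_sde_path hXY x' y' (aeW P (Wmax W1)) (aeW P (Wmax W2)).
have le_path : {ae P, forall w, forall t : R, 0 <= t ->
    half_path (X x y) w t <= half_path (X x' y') w t}.
  by apply: filterS2 h h' => w hw hw'; exact: (sde_path_comparison hbdelta hw hw').
have key tau theta : stopping_time G tau -> stopping_time G theta ->
    ('E_P[payoff x y tau theta] <= 'E_P[payoff x' y' tau theta])%E.
  move=> [tau0 _] [theta0 _]; rewrite unlock; apply: ae_le_integral_unmeasured.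
  apply: filterS3 le_path (ae_good_path x y) (ae_good_path x' y').
  move=> w le_w [cX Doo] [cX' Doo'] _.
  rewrite lee_fin !game_payoffE// /path_payoff !lerD2r.
  set mn := Order.min _ _.
  have mn0 : (0 <= mn)%E by rewrite /mn le_min tau0 theta0.
  have ip := path_integrable hdelta cX mn0 (good_path_lty mn cX Doo).
  have ip' := path_integrable hdelta cX' mn0 (good_path_lty mn cX' Doo').
  apply: le_Rintegral ip ip' _; first exact: measurable_horizon.
  by move=> t [t0 _]; rewrite ler_wpM2l ?expR_ge0// le_w.
apply: le_ereal_inf_tmp => _ [tau htau <-].
apply: (@le_trans _ _ (ereal_sup [set 'E_P[payoff x y tau theta]%E | theta in stopping_time G])).
  by apply: ereal_inf_lbound; exists tau.
apply: ge_ereal_sup => _ [theta htheta <-].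
apply: le_trans (key tau theta htau htheta) _.
by apply: ereal_sup_ubound; exists theta.
Qed.

Lemma expectation_le_bound (f : Omega -> R) (c e : R) (B : Omega -> \bar R) :
  0 <= c -> 0 <= e -> measurable_fun setT B -> (forall w, (0 <= B w)%E) ->
  {ae P, forall w, ((f w)%:E <= c%:E + e%:E * B w)%E} ->
  ('E_P[f] <= c%:E + e%:E * \int[P]_w B w)%E.
Proof.
move=> c0 e0 mB B0 fB; rewrite unlock.
apply: (@le_trans _ _ (\int[P]_w (c%:E + e%:E * B w))%E).
  by apply: ae_le_integral_unmeasured; apply: filterS fB => w h _.
rewrite ge0_integralD//; last 2 first.
- by move=> w _; rewrite mule_ge0.
- exact: measurable_funeM.
by rewrite integral_cst//= probability_setT mule1 ge0_integralZl_EFin.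
Qed.

Lemma expectation_ge_bound (f : Omega -> R) (c e : R) (B : Omega -> \bar R) :
  0 <= c -> 0 <= e -> measurable_fun setT B -> (forall w, (0 <= B w)%E) ->
  {ae P, forall w, ((- f w)%:E <= c%:E + e%:E * B w)%E} ->
  (- (c%:E + e%:E * \int[P]_w B w) <= 'E_P[f])%E.
Proof.
move=> c0 e0 mB B0 fB; rewrite unlock.
apply: (@le_trans _ _ (\int[P]_w (- (c%:E + e%:E * B w)))%E); last first.
  by apply: ae_le_integral_unmeasured; apply: filterS fB => w h _; rewrite leeNl.
rewrite integral_ge0N; last by move=> w _; rewrite adde_ge0// mule_ge0.
rewrite leeN2 ge0_integralD//; last 2 first.
- by move=> w _; rewrite mule_ge0.
- exact: measurable_funeM.
by rewrite integral_cst//= probability_setT mule1 ge0_integralZl_EFin.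
Qed.

Lemma deviation_rate_ge0 y r : 0 < r -> 0 <= rate y r.
Proof.
move=> r0; have l0 : 0 <= r ^+ 2 by rewrite exprn_ge0// ltW.
have [[[[hb' hd'] h1] h2] r0'] := (ltW hb, ltW hdelta, ltW hsigma1, ltW hsigma2, ltW r0).
rewrite /rate /deviation_rate addr_ge0//.
  by rewrite divr_ge0// addr_ge0// divr_ge0.
rewrite mulr_ge0 ?(divr_ge0 _ r0')// addr_ge0//.
  by rewrite mulr_ge0// addr_ge0// divr_ge0.
by rewrite divr_ge0// mulr_ge0// addr_ge0// divr_ge0.
Qed.

(** At t0 = r^-2, the deviation up to t0 is O (t0 / r) whereas the right-hand side
    is of order t0; so r need only be large. *)
Lemma exists_small_deviation_rate a y : 0 < a -> exists2 r, 0 < r &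
  expR 1 * (rate y r * (r ^+ 2)^-1) < a * (1 - expR (- delta * (r ^+ 2)^-1)).
Proof.
move=> a0.
have [[[hb' hd'] h1] h2] := (ltW hb, ltW hdelta, ltW hsigma1, ltW hsigma2).
pose M := `|y| + `|m| + (sigma1 * (1 + delta) + sigma2 * (1 + b)) * 7.
have d1 : 0 < 1 + delta by rewrite ltr_wpDr.
have b1 : 0 < 1 + b by rewrite ltr_wpDr.
have k1 : 0 <= sigma1 * (1 + delta) by rewrite mulr_ge0// ltW.
have k2 : 0 <= sigma2 * (1 + b) by rewrite mulr_ge0// ltW.
have M0 : 0 <= M.
  by apply: addr_ge0; [exact: addr_ge0|apply: mulr_ge0 => //; exact: addr_ge0].
(* For r >= 1 the rate is at most M / r, and 1 - exp (- u) >= u / (1 + u); the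
   inequality then reduces to C < r. *)
pose C := expR 1 * M * (1 + delta) / (a * delta).
have C0 : 0 <= C.
  apply: divr_ge0; last by rewrite mulr_ge0// ltW.
  by apply: mulr_ge0; [apply: mulr_ge0 => //; exact: expR_ge0|exact: ltW].
have r1 : 1 <= 1 + C by rewrite lerDl.
exists (1 + C); first by rewrite ltr_wpDr.
set r := 1 + C in r1 *; set l := (r ^+ 2)^-1.
have r0 : 0 < r by exact: lt_le_trans r1.
have l0 : 0 < l by rewrite invr_gt0 exprn_gt0.
have lr : l <= r^-1 by rewrite lef_pV2 ?posrE ?exprn_gt0// expr2 ler_peMr// ltW.
have l1 : l <= 1 by rewrite (le_trans lr)// invf_le1.
have rateM : rate y r <= M / r.
  rewrite /rate /deviation_rate -/l.
  apply: (@le_trans _ _ ((`|y| + `|m|) / r +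
     (sigma1 * (1 + delta) + sigma2 * (1 + b)) * (7 / r))).
    apply: lerD.
      apply: ler_pM; [|exact: ltW| |exact: lr].
        by apply: addr_ge0 => //; apply: mulr_ge0 => //; exact: ltW.
      by rewrite lerD2l ler_piMr.
    rewrite ler_wpM2r ?divr_ge0 ?(ltW r0)//; apply: lerD.
      by rewrite ler_wpM2l// lerD2l ler_piMr.
    rewrite -mulrA ler_wpM2l//.
    apply: (@le_trans _ _ (1 + b / r ^+ 2)).
      by rewrite ler_piMr// addr_ge0// divr_ge0// exprn_ge0// ltW.
    by rewrite lerD2l ler_piMr.
  by rewrite /M; lra.
have exp_lb : delta * l / (1 + delta) <= 1 - expR (- delta * l).
  have u0 : 0 <= delta * l by rewrite mulr_ge0// ltW.
  have eu : expR (- delta * l) <= (1 + delta * l)^-1.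
    by rewrite mulNr expRN lef_pV2 ?posrE ?expR_gt0 ?expR_ge1Dx// ltr_wpDr.
  apply: (@le_trans _ _ (1 - (1 + delta * l)^-1)); last by rewrite lerD2l lerN2.
  have n0 : 1 + delta * l != 0 by rewrite gt_eqF// ltr_wpDr.
  have -> : 1 - (1 + delta * l)^-1 = delta * l / (1 + delta * l) by field.
  by rewrite ler_wpM2l// lef_pV2 ?posrE ?ltr_wpDr// lerD2l ler_piMr.
apply: (@lt_le_trans _ _ (a * (delta * l / (1 + delta)))); last by rewrite ler_wpM2l// ltW.
apply: (@le_lt_trans _ _ (expR 1 * (M / r * l))).
  by rewrite ler_wpM2l ?expR_ge0// ler_wpM2r// ltW.
have -> : expR 1 * (M / r * l) = expR 1 * M / r * l by ring.
have -> : a * (delta * l / (1 + delta)) = a * delta / (1 + delta) * l by ring.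
rewrite ltr_pM2r//.
rewrite ltr_pdivrMr// -ltr_pdivrMl ?divr_gt0 ?mulr_gt0//.
have -> : (a * delta / (1 + delta))^-1 * (expR 1 * M) = C.
  by rewrite /C; field; rewrite !gt_eqF.
by rewrite /r ltrDr.
Qed.

(** Common part of the two strict inequalities on U: the bound of
    [path_payoff_short_stop_le] has expectation less than K for a suitable t0. *)
Lemma short_stop_budget x y K x0 : 0 <= x0 -> x0 < K * delta ->
  exists t0 c (B : Omega -> \bar R),
  [/\ 0 < t0 /\ 0 <= c, measurable_fun setT B, forall w, (0 <= B w)%E,
      (c%:E + (expR 1)%:E * \int[P]_w B w < K%:E)%E &
      {ae P, forall w, ((K - (K - x0 / delta) * (1 - expR (- delta * t0)) +
         fine (discounted delta t0%:E (dev x y w)))%:E <= c%:E + (expR 1)%:E * B w)%E}].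
Proof.
move=> x00 x0K; pose a := K - x0 / delta.
have a0 : 0 < a by rewrite subr_gt0 ltr_pdivrMr.
have [r r0 small] := exists_small_deviation_rate y a0.
have l0 : 0 < r ^+ 2 by rewrite exprn_gt0.
set t0 := (r ^+ 2)^-1 in small.
have t00 : 0 < t0 by rewrite invr_gt0.
have e0 := expR_ge0 (1 : R).
have [B [mB B0 dB iB _]] := deviation_bound_lty x y r0 (stopping_time_cst (leey _)).
pose c := K - a * (1 - expR (- delta * t0)).
exists t0, c, B; split => //.
- split=> //; have f0 := expR_ge0 (- delta * t0).
  have f1 : expR (- delta * t0) <= 1 by rewrite expR_le1 mulNr oppr_le0 mulr_ge0// ltW.
  have aK : a <= K by rewrite gerBl divr_ge0// ltW.
  rewrite subr_ge0; apply: le_trans aK; apply: ler_piMr; first exact: ltW.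
  by rewrite gerBl.
- have : (\int[P]_w B w <= (rate y r * t0)%:E)%E.
    apply: le_trans iB _; rewrite EFinM lee_wpmul2l ?lee_fin ?deviation_rate_ge0//.
    by apply: integral_discounted_const1_le => // w; exact: leey.
  move=> /(lee_wpmul2l (expR_ge0 1 : (0 <= (expR 1)%:E)%E)) h.
  apply: le_lt_trans (leeD2l c%:E h) _; rewrite -EFinM -EFinD lte_fin /c; lra.
apply: filterS2 (ae_good_path x y) dB => w [cX Doo] dBw.
have Dt := good_path_lty t0%:E cX Doo.
rewrite EFinD leeD2l// fineK; last first.
  by rewrite ge0_fin_numE//; apply: discounted_ge0 => *; exact: deviation_ge0.
apply: le_trans (discounted_short_horizon (ltW hdelta) l0 (measurable_deviation cX)
  (deviation_ge0 x y w)) _.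
by rewrite lee_wpmul2l// lee_fin.
Qed.

(** The minimiser stops at the deterministic time given by [short_stop_budget]. *)
Lemma game_value_lt_Km x y : x < Km * delta -> (U x y < Km%:E)%E.
Proof.
move=> xK; pose x0 := Num.max x 0.
have x00 : 0 <= x0 by rewrite le_max lexx orbT.
have xx0 : x <= x0 by rewrite le_max lexx.
have x0K : x0 < Km * delta by rewrite gt_max xK mulr_gt0.
have [t0 [c [B [[t00 c0] mB B0 bound aeB]]]] := short_stop_budget x y x00 x0K.
apply: le_lt_trans bound.
pose tau := (fun=> t0%:E) : Omega -> \bar R.
have htau : stopping_time G tau by apply: stopping_time_cst; rewrite lee_fin ltW.
apply: (@le_trans _ _ (ereal_sup [set 'E_P[payoff x y tau theta]%E | theta in stopping_time G])).
  by apply: ereal_inf_lbound; exists tau.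
apply: ge_ereal_sup => _ [theta [theta0 _] <-].
apply: expectation_le_bound => //.
apply: filterS2 (ae_good_path x y) aeB => w [cX Doo]; apply: le_trans.
rewrite game_payoffE ?lee_fin ?(ltW t00)//.
exact: (path_payoff_short_stop_le hdelta cX (ltW hKp) xx0 x00 (ltW x0K) (ltW t00)
  (theta0 w) (good_path_lty t0%:E cX Doo)).
Qed.

(** The mirror image of [game_value_lt_Km], the maximiser stopping at a small
    deterministic time. *)
Lemma game_value_gt_Kp x y : - (Kp * delta) < x -> ((- Kp)%:E < U x y)%E.
Proof.
move=> xK; pose x0 := Num.max (- x) 0.
have x00 : 0 <= x0 by rewrite le_max lexx orbT.
have xx0 : - x <= x0 by rewrite le_max lexx.
have x0K : x0 < Kp * delta by rewrite gt_max ltrNl xK mulr_gt0.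
have [t0 [c [B [[t00 c0] mB B0 bound aeB]]]] := short_stop_budget x y x00 x0K.
apply: (@lt_le_trans _ _ (- (c%:E + (expR 1)%:E * \int[P]_w B w))%E).
  by rewrite EFinN lteN2.
pose theta := (fun=> t0%:E) : Omega -> \bar R.
have htheta : stopping_time G theta by apply: stopping_time_cst; rewrite lee_fin ltW.
apply: le_ereal_inf_tmp => _ [tau [tau0 _] <-].
apply: (@le_trans _ _ ('E_P[payoff x y tau theta]%E)); last first.
  by apply: ereal_sup_ubound; exists theta.
apply: expectation_ge_bound => //.
apply: filterS2 (ae_good_path x y) aeB => w [cX Doo]; apply: le_trans.
rewrite game_payoffE ?lee_fin ?(ltW t00)//.
have mn0 : (0 <= Order.min (tau w) (theta w))%E by rewrite le_min tau0 lee_fin ltW.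
rewrite path_payoff_opp ?opprK; last first.
  exact: (path_integrable hdelta cX mn0 (good_path_lty _ cX Doo)).
have cNX : continuous (fun t => - half_path (X x y) w t).
  by move=> t; apply: (@continuousN _ R^o); exact: cX.
have devN : dev x y w = (fun t => `|- half_path (X x y) w t - - x * expR (- delta * t)|).
  by apply/funext => t; rewrite /dev /deviation -[LHS]normrN opprB [- x * _]mulNr opprK addrC.
have Dt := good_path_lty t0%:E cX Doo; rewrite devN in Dt *.
exact: (path_payoff_short_stop_le hdelta cNX (ltW hKm) xx0 x00 (ltW x0K) (ltW t00)
  (tau0 w) Dt).
Qed.

Section NeverStop.
Variables (K c : R) (N B : Omega -> \bar R).
Hypothesis K0 : 0 <= K.
Hypothesis c0 : 0 <= c.
Hypothesis mN : measurable_fun setT N.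
Hypothesis mB : measurable_fun setT B.
Hypothesis N0 : forall w, (0 <= N w)%E.
Hypothesis B0 : forall w, (0 <= B w)%E.
Hypothesis Boo : (\int[P]_w B w < +oo)%E.
Hypothesis Noo : (\int[P]_w N w < +oo)%E.
Hypothesis BN : (\int[P]_w B w <= c%:E * \int[P]_w N w)%E.

Let g w := (K%:E + c%:E * N w - B w)%E.

Let KN_ge0 w : (0 <= K%:E + c%:E * N w)%E.
Proof. by rewrite adde_ge0// mule_ge0. Qed.

Let mKN : measurable_fun setT (fun w => K%:E + c%:E * N w)%E.
Proof. by apply: emeasurable_funD; [exact: measurable_cst|exact: measurable_funeM]. Qed.

Let intKN : (\int[P]_w (K%:E + c%:E * N w) = K%:E + c%:E * \int[P]_w N w)%E.
Proof.
rewrite ge0_integralD//; last 2 first.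
- by move=> w _; rewrite mule_ge0.
- exact: measurable_funeM.
by rewrite integral_cst//= probability_setT mule1 ge0_integralZl_EFin.
Qed.

Let NE : (\int[P]_w N w)%E \is a fin_num.
Proof. by rewrite ge0_fin_numE//; exact: integral_ge0. Qed.

Let BE : (\int[P]_w B w)%E \is a fin_num.
Proof. by rewrite ge0_fin_numE//; exact: integral_ge0. Qed.

Let iKN : P.-integrable setT (fun w => K%:E + c%:E * N w)%E.
Proof.
apply/integrableP; split => //; under eq_integral do rewrite gee0_abs//.
by rewrite intKN -(fineK NE) -EFinM -EFinD ltry.
Qed.

Let iB : P.-integrable setT B.
Proof.
by apply/integrableP; split => //; under eq_integral do rewrite gee0_abs//.
Qed.

Let int_g : (K%:E <= \int[P]_w g w)%E.
Proof.
rewrite integralB// intKN leeBrDr// leeD2l//.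
Qed.

(** The majorant B of the deviation is compensated in expectation by c N, where N
    is the discounted duration; it is subtracted as an integrable function because
    B may be infinite on a null set. *)
Lemma expectation_never_stop_ge (f : Omega -> R) :
  {ae P, forall w, (g w <= (f w)%:E)%E} -> (K%:E <= 'E_P[f])%E.
Proof.
move=> gf; apply: le_trans int_g _; rewrite unlock.
by apply: ae_le_integral_unmeasured; apply: filterS gf => w h _.
Qed.

Lemma expectation_never_stop_le (f : Omega -> R) :
  {ae P, forall w, (g w <= (- f w)%:E)%E} -> ('E_P[f] <= (- K)%:E)%E.
Proof.
move=> gf; apply: (@le_trans _ _ (- \int[P]_w g w)%E); last by rewrite EFinN leeN2.
have ig : P.-integrable setT g by exact: (integrableB _ iKN iB).
rewrite -integralN; last exact: integrable_add_def.
rewrite unlock; apply: ae_le_integral_unmeasured; apply: filterS gf => w h _.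
by rewrite leeNr.
Qed.

End NeverStop.

(** [deviation_bound_lty] at the discount rate delta of the game. *)
Lemma stopped_deviation_bound x y (sg : Omega -> \bar R) : stopping_time G sg ->
  exists B : Omega -> \bar R,
  [/\ measurable_fun setT B, forall w, (0 <= B w)%E,
      {ae P, forall w, (discounted delta (sg w) (dev x y w) <= B w)%E},
      (\int[P]_w B w <= (rate y (Num.sqrt delta))%:E *
         \int[P]_w discounted delta (sg w) (fun=> 1%R))%E &
      (\int[P]_w B w < +oo)%E].
Proof.
move=> hsg; have r0 : 0 < Num.sqrt delta by rewrite sqrtr_gt0.
have [B [mB B0 dB iB [Boo _]]] := deviation_bound_lty x y r0 hsg.
by rewrite (sqr_sqrtr (ltW hdelta)) in dB iB; exists B.
Qed.

Lemma measurable_discounted_const1 (sg : Omega -> \bar R) : stopping_time G sg ->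
  measurable_fun setT (fun w => discounted delta (sg w) (fun=> 1)).
Proof.
move=> hsg; have [[aW1 aW2] _ _ _ _] := hW.
have msg := measurable_stopping_time hF aW1 aW2 hsg.
exact: (@measurable_discounted _ _ _ delta sg (fun=> fun=> 1)).
Qed.

(** With this x, the coefficient x / 2 - delta Km of the discounted duration
    in [path_payoff_never_stop_ge] equals the constant of the deviation bound. *)
Lemma game_value_ge_Km y : exists x, (Km%:E <= U x y)%E.
Proof.
set c := rate y (Num.sqrt delta).
have c0 : 0 <= c by apply: deviation_rate_ge0; rewrite sqrtr_gt0.
pose x := 2 * (delta * Km + c).
have x0 : 0 <= x by rewrite mulr_ge0// addr_ge0// mulr_ge0// ltW.
have cE : x / 2 - delta * Km = c by rewrite /x; field.
exists x; apply: le_ereal_inf_tmp => _ [tau htau <-].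
have hoo := @stopping_time_cst +oo%E (leey _).
apply: (@le_trans _ _ ('E_P[payoff x y tau (fun=> +oo%E)]%E)); last first.
  by apply: ereal_sup_ubound; exists (fun=> +oo%E).
have [tau0 _] := htau.
have [B [mB B0 dB iB Boo]] := stopped_deviation_bound x y htau.
pose N w := discounted delta (tau w) (fun=> 1).
have N0 w : (0 <= N w)%E by exact: discounted_ge0.
have Noo : (\int[P]_w N w < +oo)%E.
  exact: le_lt_trans (integral_discounted_const1_le P hdelta tau0) (ltry _).
have mN := measurable_discounted_const1 htau.
apply: (expectation_never_stop_ge (ltW hKm) c0 mN mB N0 B0 Boo Noo iB).
apply: filterS2 (ae_good_path x y) dB => w [cX Doo] dBw.
have Dt := good_path_lty (tau w) cX Doo.
have Nfin : discounted delta (tau w) (fun=> 1) \is a fin_num.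
  by rewrite discounted_const1.
have Dfin : discounted delta (tau w) (dev x y w) \is a fin_num.
  by rewrite ge0_fin_numE//; apply: discounted_ge0 => *; exact: deviation_ge0.
rewrite game_payoffE//.
have := path_payoff_never_stop_ge hdelta cX Kp Km x0 (tau0 w) Dt.
rewrite cE -lee_fin; apply: le_trans.
apply: (@le_trans _ _ (Km%:E + c%:E * N w - discounted delta (tau w) (dev x y w))%E).
  by rewrite leeD2l// leeN2.
have NE : N w = (fine (N w))%:E by rewrite (fineK Nfin).
rewrite {1}NE -{1}(fineK Dfin); exact: lexx.
Qed.

(** The mirror image of [game_value_ge_Km], the minimiser never stopping. *)
Lemma game_value_le_Kp y : exists x, (U x y <= (- Kp)%:E)%E.
Proof.
set c := rate y (Num.sqrt delta).
have c0 : 0 <= c by apply: deviation_rate_ge0; rewrite sqrtr_gt0.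
pose x' := 2 * (delta * Kp + c).
have x0 : 0 <= x' by rewrite mulr_ge0// addr_ge0// mulr_ge0// ltW.
have cE : x' / 2 - delta * Kp = c by rewrite /x'; field.
pose x := - x'; exists x.
pose tau := (fun=> +oo%E) : Omega -> \bar R.
have hoo : stopping_time G tau := @stopping_time_cst +oo%E (leey _).
apply: (@le_trans _ _ (ereal_sup [set 'E_P[payoff x y tau theta]%E | theta in stopping_time G])).
  by apply: ereal_inf_lbound; exists tau.
apply: ge_ereal_sup => _ [theta htheta <-].
have [theta0 _] := htheta.
have [B [mB B0 dB iB Boo]] := stopped_deviation_bound x y htheta.
pose N w := discounted delta (theta w) (fun=> 1).
have N0 w : (0 <= N w)%E by exact: discounted_ge0.
have Noo : (\int[P]_w N w < +oo)%E.
  exact: le_lt_trans (integral_discounted_const1_le P hdelta theta0) (ltry _).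
have mN := measurable_discounted_const1 htheta.
apply: (expectation_never_stop_le (ltW hKp) c0 mN mB N0 B0 Boo Noo iB).
apply: filterS2 (ae_good_path x y) dB => w [cX Doo] dBw.
have Dt := good_path_lty (theta w) cX Doo.
have Nfin : discounted delta (theta w) (fun=> 1) \is a fin_num.
  by rewrite discounted_const1.
have Dfin : discounted delta (theta w) (dev x y w) \is a fin_num.
  by rewrite ge0_fin_numE//; apply: discounted_ge0 => *; exact: deviation_ge0.
rewrite game_payoffE//; last exact: leey.
have mn0 : (0 <= Order.min (tau w) (theta w))%E by rewrite le_min theta0 leey.
rewrite path_payoff_opp ?opprK; last first.
  exact: (path_integrable hdelta cX mn0 (good_path_lty _ cX Doo)).
have cNX : continuous (fun t => - half_path (X x y) w t).
  by move=> t; apply: (@continuousN _ R^o); exact: cX.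
have devN : dev x y w = (fun t => `|- half_path (X x y) w t - x' * expR (- delta * t)|).
  apply/funext => t; rewrite /dev /deviation -[LHS]normrN opprB.
  by rewrite [x * _]mulNr addrC.
have Dt' := Dt; rewrite devN in Dt'.
have := path_payoff_never_stop_ge hdelta cNX Km Kp x0 (theta0 w) Dt'.
rewrite -devN cE -lee_fin; apply: le_trans.
apply: (@le_trans _ _ (Kp%:E + c%:E * N w - discounted delta (theta w) (dev x y w))%E).
  by rewrite leeD2l// leeN2.
have NE : N w = (fine (N w))%:E by rewrite (fineK Nfin).
rewrite {1}NE -{1}(fineK Dfin); exact: lexx.
Qed.

End GameValue.

(** * The free boundaries of the game *)

Theorem lemma3p17 (R : realType) (d : measure_display)
  (Omega : measurableType d) (P : probability Omega R)
  (F : R -> set (set Omega)) (W1 W2 : R -> Omega -> R)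
  (m b delta sigma1 sigma2 Kp Km rho : R)
  (X : R -> R -> R -> Omega -> R) (Y : R -> R -> Omega -> R)
  (hb : 0 < b) (hdelta : 0 < delta) (hsigma1 : 0 < sigma1)
  (hsigma2 : 0 < sigma2) (hKp : 0 < Kp) (hKm : 0 < Km)
  (hbdelta : delta < b) (hrho : `|rho| < 1)
  (hF : complete_filtration P F)
  (hW : correlated_brownian_motions P F rho W1 W2)
  (hXY : forall x y : R,
     solves_sde P F W1 W2 m b delta sigma1 sigma2 x y (X x y) (Y y)) :
  let U := game_value P (brownian_filtration P W1 W2) delta Kp Km X in
  let am := a_minus U Km in
  let ap := a_plus U Kp in
  [/\ (* (i) *)
      [/\ {homo am : y y' / y <= y' >-> (y' <= y)%E},
          {homo ap : y y' / y <= y' >-> (y' <= y)%E},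
          forall y : R, am z @[z --> y^'+] --> am y &
          forall y : R, ap z @[z --> y^'-] --> ap y],
      (* (ii) *)
      forall y : R,
        [/\ (ap y <= (dcost_inv (- Kp * delta))%:E)%E,
            dcost_inv (- Kp * delta) < dcost_inv (Km * delta) &
            ((dcost_inv (Km * delta))%:E <= am y)%E],
      (* (iii) *)
      forall y : R, (-oo < ap y)%E /\ (am y < +oo)%E &
      (* (iv): both boundaries are real-valued by (ii) and (iii) *)
      [lipschitz fine (ap y) | y in [set: R]] /\
      [lipschitz fine (am y) | y in [set: R]]].
Proof.
move=> U am ap.
pose L := (b - delta)^-1.
have L0 : 0 <= L by rewrite invr_ge0 subr_ge0 ltW.
have U_mono (x x' y y' : R) : x <= x' -> 0 <= (x' - x) + (y' - y) * L ->
    (U x y <= U x' y')%E.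
  exact: (game_value_mono Kp Km hb hdelta hsigma1 hsigma2 hbdelta hF hW hXY).
have Km_lb (x y : R) : (Km%:E <= U x y)%E -> Km * delta <= x.
  move=> h; rewrite leNgt; apply/negP => xK; move: h; apply/negP; rewrite -ltNge.
  exact: (game_value_lt_Km hb hdelta hsigma1 hsigma2 hKp hKm hF hW hXY y xK).
have Kp_ub (x y : R) : (U x y <= (- Kp)%:E)%E -> x <= - (Kp * delta).
  move=> h; rewrite leNgt; apply/negP => xK; move: h; apply/negP; rewrite -ltNge.
  exact: (game_value_gt_Kp hb hdelta hsigma1 hsigma2 hKp hKm hF hW hXY y xK).
have Km_reached (y : R) : exists x, (Km%:E <= U x y)%E.
  exact: (game_value_ge_Km Kp hb hdelta hsigma1 hsigma2 hKm hF hW hXY).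
have Kp_reached (y : R) : exists x, (U x y <= (- Kp)%:E)%E.
  exact: (game_value_le_Kp Km hb hdelta hsigma1 hsigma2 hKp hF hW hXY).
split.
- split.
  + by move=> y y' yy'; apply: (@a_minus_noninc R U L Km L0 U_mono).
  + by move=> y y' yy'; apply: (@a_plus_noninc R U L Kp L0 U_mono).
  + move=> y; apply: cvg_at_right_filter.
    exact: (a_minus_continuous L0 U_mono Km_lb Km_reached).
  + move=> y; apply: cvg_at_left_filter.
    exact: (a_plus_continuous L0 U_mono Kp_ub Kp_reached).
- move=> y; rewrite !dcost_invE mulNr; split.
  + exact: (a_plus_le Kp_ub).
  + by rewrite (@lt_trans _ _ 0)// ?oppr_lt0 mulr_gt0.
  + exact: (a_minus_ge Km_lb).
- by move=> y; split; [exact: (a_plus_gtNy Kp_reached)|exact: (a_minus_lty Km_reached)].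
- split.
  + exact: (lipschitz_bound_lipschitz (a_plus_lipschitz_bound L0 U_mono Kp_ub Kp_reached)).
  + exact: (lipschitz_bound_lipschitz (a_minus_lipschitz_bound L0 U_mono Km_lb Km_reached)).
Qed.
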